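(* For every integer $2\leq p<\infty$, the group of extendible Bogolubov automorphisms of $\mathcal{O}_p$ defines an outer action of $\mathbb{T}\times\mathbb{Z}/2\mathbb{Z}$ on $\mathcal{Q}_p$ (each extendible Bogolubov automorphism acting by its unique extension to an automorphism of $\mathcal{Q}_p$).
   Context: For an integer $2\leq p<\infty$, the $p$-adic ring $C^*$-algebra $\mathcal{Q}_p$ is the universal $C^*$-algebra generated by a unitary $u$ and an isometry $s_p$ subject to $s_pu=u^ps_p$ and $\sum_{i=0}^{p-1}u^is_ps_p^*u^{-i}=1$. The isometries $T_i=u^is_p$, $0\leq i\leq p-1$, generate a copy of the Cuntz algebra $\mathcal{O}_p$ inside $\mathcal{Q}_p$. For a unitary matrix $A=(a_{i,j})_{0\leq i,j\leq p-1}\in\mathcal{U}_p(\mathbb{C})$, the Bogolubov automorphism $\lambda_A$ of $\mathcal{O}_p$ is determined by $\lambda_A(T_i)=\sum_{j=0}^{p-1}a_{j,i}T_j$. It is extendible if it extends to an automorphism of $\mathcal{Q}_p$; such an extension is unique. The extendible Bogolubov automorphisms are exactly the $\lambda_A$ with $A\in\{zB\mid z\in\mathbb{T},\ B\in\{1,E\}\}\cong\mathbb{T}\times\mathbb{Z}/2\mathbb{Z}$, where $E=(\delta_{p-i+1,j})_{1\leq i,j\leq p}$ is the exchange matrix; the extension of $\lambda_{z1}$ is $u\mapsto u$, $s_p\mapsto zs_p$, and the extension of $\lambda_{zE}$ is $u\mapsto u^*$, $s_p\mapsto zu^{p-1}s_p$. An action is outer if every non-trivial group element acts by an automorphism that is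 not of the form ${\rm Ad}(w)$ for a unitary $w$ in the algebra.
   Formalization: For p≥3 more Bogolubov automorphisms extend (u→cu, s→s with c^{p-1}=1), so they do not form T×Z/2Z; the theorem shows that the λ_{zB}, B∈{1,E}, give an outer T×Z/2Z-action and that every non-trivial extendible one is outer, with unique extension. *)

(* Defs.v *)
From HB Require Import structures.
From mathcomp Require Import all_boot all_order all_algebra.
From mathcomp Require Import all_classical all_reals all_analysis.
From mathcomp Require Import complex.

Set Implicit Arguments.
Unset Strict Implicit.
Unset Printing Implicit Defensive.

Import Order.TTheory GRing.Theory Num.Theory numFieldNormedType.Exports.

Local Open Scope classical_set_scope.
Local Open Scope ring_scope.

(* Unital C*-algebras over the complex numbers R[i], with a real-valued norm.
   The carrier is not also declared as a completeNormedModType: the hierarchy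
   has no join of algType and normedModType.  The library's algebras are
   non-zero; since every *-homomorphism to the zero algebra is trivial, leaving
   it out does not change the universal property below. *)
HB.mixin Record Algebra_isCStar (R : realType) A & GRing.Algebra R[i] A := {
  cnorm : A -> R;
  star : A -> A;
  cnormD : forall x y : A, cnorm (x + y) <= cnorm x + cnorm y;
  cnormZ : forall (a : R[i]) (x : A),
    (cnorm (a *: x))%:C%C = `|a| * (cnorm x)%:C%C;
  cnorm0_eq0 : forall x : A, cnorm x = 0 -> x = 0;
  cnormM : forall x y : A, cnorm (x * y) <= cnorm x * cnorm y;
  cnorm_complete : forall x : nat -> A,
    (forall e : R, 0 < e -> exists N, forall m n,
       (N <= m)%N -> (N <= n)%N -> cnorm (x m - x n) < e) ->
    exists l : A, cnorm (x n - l) @[n --> \oo] --> (0 : R);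
  starK : involutive star;
  star_semilinear : forall (a : R[i]) (x y : A),
    star (a *: x + y) = Num.conj a *: star x + star y;
  starM : forall x y : A, star (x * y) = star y * star x;
  cnorm_star : forall x : A, cnorm (star x * x) = cnorm x ^+ 2
}.

#[short(type="cstarType")]
HB.structure Definition CStarAlgebra (R : realType) :=
  {A of Algebra_isCStar R A & GRing.Algebra R[i] A}.

Section CStar.
Variable R : realType.
Implicit Types A B : cstarType R.

Definition is_unitary A (w : A) := star w * w = 1 /\ w * star w = 1.

Definition is_isometry A (t : A) := star t * t = 1.

Definition star_hom A B (f : A -> B) :=
  [/\ linear f, GRing.monoid_morphism f & forall x, f (star x) = star (f x)].

Definition star_automorphism A (f : A -> A) := star_hom f /\ bijective f.

Definition is_inner A (f : A -> A) :=
  exists2 w : A, is_unitary w & forall x, f x = w * x * star w.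

Definition cstar_subalgebra A (S : set A) :=
  [/\ S 0,
      forall (a : R[i]) x y, S x -> S y -> S (a *: x + y),
      forall x y, S x -> S y -> S (x * y),
      forall x, S x -> S (star x) &
      forall (x : nat -> A) (l : A), (forall n, S (x n)) ->
        cnorm (x n - l) @[n --> \oo] --> (0 : R) -> S l].

Definition cstar_gen A (X : set A) : set A :=
  \bigcap_(S in [set S | cstar_subalgebra S /\ X `<=` S]) S.

(* *-automorphisms of a C*-subalgebra S, as functions of which only the values
   on S matter. *)
Definition star_automorphism_on A (S : set A) (f : A -> A) :=
  [/\ set_bij S S f,
      forall (a : R[i]) x y, S x -> S y -> f (a *: x + y) = a *: f x + f y,
      forall x y, S x -> S y -> f (x * y) = f x * f y &
      forall x, S x -> f (star x) = star (f x)].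

Section PadicRing.
Variables (p : nat) (A : cstarType R) (u s : A).

Definition Qp_relations :=
  [/\ is_unitary u, is_isometry s, s * u = u ^+ p * s &
      \sum_(i < p) u ^+ i * s * star s * star u ^+ i = 1].

Definition cuntz_gen (i : 'I_p) : A := u ^+ i * s.

Definition cuntz_subalgebra : set A := cstar_gen (range cuntz_gen).

(* lam is the Bogolubov automorphism of O_p attached to the unitary matrix M *)
Definition is_bogolubov (M : 'M[R[i]]_p) (lam : A -> A) :=
  [/\ M \is unitarymx, star_automorphism_on cuntz_subalgebra lam &
      forall i, lam (cuntz_gen i) = \sum_(j < p) M j i *: cuntz_gen j].

(* phi is an automorphism of the whole algebra extending lambda_M *)
Definition extends_bogolubov (M : 'M[R[i]]_p) (phi : A -> A) :=
  star_automorphism phi /\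
  exists2 lam, is_bogolubov M lam & {in cuntz_subalgebra, phi =1 lam}.

End PadicRing.

(* (Q, u, s) is the universal C*-algebra Q_p with its canonical generators;
   this determines it up to a unique *-isomorphism. *)
Definition is_Qp (p : nat) (Q : cstarType R) (u s : Q) :=
  [/\ Qp_relations p u s,
      cstar_gen [set u; s] = setT &
      forall (B : cstarType R) (v t : B), Qp_relations p v t ->
        exists f : Q -> B, [/\ star_hom f, f u = v & f s = t]].

End CStar.

Record circle (R : realType) := Circle {
  circle_val :> R[i];
  circle_norm : `|circle_val| == 1
}.

HB.instance Definition _ R := [isSub for @circle_val R].
HB.instance Definition _ R := [Choice of circle R by <:].

Section CircleGroup.
Variable R : realType.
Implicit Types z w : circle R.

Fact circle1_subproof : `|1 : R[i]| == 1. Proof. by rewrite normr1. Qed.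
Fact circleV_subproof z : `|(z : R[i])^-1| == 1.
Proof. by rewrite normfV (eqP (circle_norm z)) invr1. Qed.
Fact circleM_subproof z w : `|(z : R[i]) * w| == 1.
Proof. by rewrite normrM !(eqP (circle_norm _)) mulr1. Qed.

Definition circle_one := Circle circle1_subproof.
Definition circle_inv z := Circle (circleV_subproof z).
Definition circle_mul z w := Circle (circleM_subproof z w).

Fact circle_neq0 z : (z : R[i]) != 0.
Proof. by rewrite -normr_eq0 (eqP (circle_norm z)) oner_eq0. Qed.

Fact circle_mulA : associative circle_mul.
Proof. by move=> x y z; apply/val_inj; rewrite /= mulrA. Qed.
Fact circle_mulC : commutative circle_mul.
Proof. by move=> x y; apply/val_inj; rewrite /= mulrC. Qed.
Fact circle_mul1 : left_id circle_one circle_mul.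
Proof. by move=> x; apply/val_inj; rewrite /= mul1r. Qed.
Fact circle_mulV : left_inverse circle_one circle_inv circle_mul.
Proof. by move=> x; apply/val_inj; rewrite /= mulVf ?circle_neq0. Qed.

End CircleGroup.

HB.instance Definition _ (R : realType) :=
  Topological.copy (circle R)
    (initial_topology (fun z : circle R => (z : R[i]^o))).

(* Z/2Z is bool with addition addb: (z, false) and (z, true) stand for z1 and
   zE. *)
Definition TxZ2 (R : realType) : Type := (circle R * bool)%type.

HB.instance Definition _ (R : realType) :=
  Topological.copy (TxZ2 R) (circle R * bool)%type.

Section TxZ2Group.
Variable R : realType.
Implicit Types g h : TxZ2 R.

Definition TxZ2_one : TxZ2 R := (circle_one R, false).
Definition TxZ2_inv g : TxZ2 R := (circle_inv g.1, g.2).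
Definition TxZ2_mul g h : TxZ2 R := (circle_mul g.1 h.1, g.2 (+) h.2).

Fact TxZ2_mulA : associative TxZ2_mul.
Proof. by move=> x y z; rewrite /TxZ2_mul circle_mulA addbA. Qed.
Fact TxZ2_mul1 : left_id TxZ2_one TxZ2_mul.
Proof. by case=> z b; rewrite /TxZ2_mul circle_mul1. Qed.
Fact TxZ2_mulr1 : right_id TxZ2_one TxZ2_mul.
Proof. by case=> z b; rewrite /TxZ2_mul circle_mulC circle_mul1 addbF. Qed.
Fact TxZ2_mulV : left_inverse TxZ2_one TxZ2_inv TxZ2_mul.
Proof. by case=> z b; rewrite /TxZ2_mul circle_mulV addbb. Qed.
Fact TxZ2_mulrV : right_inverse TxZ2_one TxZ2_inv TxZ2_mul.
Proof. by case=> z b; rewrite /TxZ2_mul circle_mulC circle_mulV addbb. Qed.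

HB.instance Definition _ := isGroup.Build (TxZ2 R)
  TxZ2_mulA TxZ2_mul1 TxZ2_mulr1 TxZ2_mulV TxZ2_mulrV.

End TxZ2Group.

Definition exchange_mx (R : realType) (p : nat) : 'M[R[i]]_p :=
  \matrix_(i, j) (j == rev_ord i)%:R.

Definition TxZ2_mx (R : realType) (p : nat) (g : TxZ2 R) : 'M[R[i]]_p :=
  (g.1 : R[i]) *: (if g.2 then exchange_mx R p else 1%:M).

(* Actions of T x Z/2Z on a C*-algebra by *-automorphisms; as usual for a
   topological group, the orbit maps are required to be norm continuous. *)
Definition is_action (R : realType) (A : cstarType R)
    (alpha : TxZ2 R -> A -> A) :=
  [/\ forall g, star_automorphism (alpha g),
      forall x, alpha 1%g x = x,
      forall g h x, alpha (g * h)%g x = alpha g (alpha h x) &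
      forall x g, cnorm (alpha h x - alpha g x) @[h --> g] --> (0 : R)].

Definition is_outer_action (R : realType) (A : cstarType R)
    (alpha : TxZ2 R -> A -> A) :=
  is_action alpha /\ forall g, g <> 1%g -> ~ is_inner (alpha g).

(* Main.v *)
Require Import Defs.
From HB Require Import structures.
From mathcomp Require Import all_boot all_order all_algebra.
From mathcomp Require Import all_classical all_reals all_analysis.
From mathcomp Require Import complex.
From mathcomp Require Import lra zify.

Set Implicit Arguments.
Unset Strict Implicit.
Unset Printing Implicit Defensive.

Import Order.TTheory GRing.Theory Num.Theory numFieldNormedType.Exports.

Local Open Scope classical_set_scope.
Local Open Scope ring_scope.
Import Defs.

(** Throughout, T_i = u^i s, and U c is the integer power u^c.  The proof uses norm
    estimates only; no representation, state or spectrum occurs in it.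

    Sequences of uniformly bounded linear maps are tested on a dense subspace: the algebra
    is the closed span of the products U a s^m star(s)^n U b, and these arise from the
    elements U c s^r and their adjoints by repeated use of v |-> T_i v star(T_j)
    ([Qp_ind]).

    Outerness.  Suppose that w is a unitary with w T_i = lambda_M(T_i) w.  Let E(v) be the
    average over i of star(T_i) v T'_i, where T'_i is T_i moved by the inverse of M.  Then E
    is a linear contraction and E(w) = w.  It maps T_i v star(T_j) to a multiple of v, its
    iterates tend to 0 on U c s^r for r > 0, and they drive the powers of u towards the
    scalars, because the exponents shrink until only u and its adjoint are left, with a
    coefficient of modulus at most 1 / p.  So the iterates of E on any v are asymptotically
    central ([mean_commutator_vanishes]), which makes w central and M = 1
    ([extension_outer]).

    Uniqueness.  Two extensions of lambda_M differ by an automorphism chi that fixes every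
    T_i.  The element x = chi(u) star(u) commutes with s and satisfies x u s = u s.
    Compressing by high powers of s brings any element close to the span of the powers of s
    and their adjoints.  On this span the maps v |-> star(B_n) v B_n / (n + 1), for a
    suitable B_n built from the wandering isometries s^k u s, act as Fejer means, so they
    approximate the identity; but they send x to 1.  Hence x = 1
    ([shift_commutant_trivial]) and chi is the identity.

    The action.  The universal property turns the formulas for the extensions of
    lambda_z1 and lambda_zE into endomorphisms.  The group law, invertibility and norm
    continuity are checked on u and s; passing to the whole algebra uses that
    *-homomorphisms are contractive ([hom_contractive]).  For this, a self-adjoint h with
    |h| < 1 has a self-adjoint commuting companion g with h^2 + g^2 = 1, obtained by
    iterating a contraction ([sqrt_one_sub]), and such an identity bounds the norm of h and
    is preserved by homomorphisms.  The same square roots show that positive elements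
    with sum 0 vanish ([sum_positive_eq0]), so that sum_i T_i star(T_i) = 1 forces the
    isometries T_i to be orthogonal, on which all computations rest. *)

(** * Norm and involution *)

Section Basics.
Variable R : realType.
Implicit Types (a b : R[i]).

(** The norm axioms mix real norms with complex scalars; taking the absolute value of
    a scalar as a real number keeps every later estimate in [R]. *)
Definition modulus a : R := complex.Re `|a|.

Lemma modulusE a : (modulus a)%:C%C = `|a|.
Proof. by rewrite /modulus normc_def. Qed.

Lemma modulus_ge0 a : 0 <= modulus a.
Proof. by rewrite -lecR modulusE normr_ge0. Qed.

Lemma modulusM a b : modulus (a * b) = modulus a * modulus b.
Proof. by apply: complexI; rewrite rmorphM /= !modulusE normrM. Qed.

Lemma modulus_real (x : R) : modulus x%:C%C = `|x|.
Proof. by apply: complexI; rewrite modulusE normc_def /= expr0n addr0 sqrtr_sqr. Qed.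

Lemma modulus_conj a : modulus (Num.conj a) = modulus a.
Proof. by apply: complexI; rewrite !modulusE norm_conjC. Qed.

Lemma modulus_nat n : modulus n%:R = n%:R.
Proof. by apply: complexI; rewrite modulusE normr_nat rmorph_nat. Qed.

Lemma modulusN a : modulus (- a) = modulus a.
Proof. by apply: complexI; rewrite !modulusE normrN. Qed.

Lemma modulusV a : modulus a^-1 = (modulus a)^-1.
Proof. by apply: complexI; rewrite fmorphV /= !modulusE normfV. Qed.

Variable A : cstarType R.
Implicit Types x y z : A.

Lemma cnormZr a x : cnorm (a *: x) = modulus a * cnorm x.
Proof. by apply: complexI; rewrite cnormZ rmorphM /= modulusE. Qed.

Lemma cnorm0 : cnorm (0 : A) = 0.
Proof. by rewrite -(scale0r (0 : A)) cnormZr (modulus_nat 0) mul0r. Qed.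

Lemma cnormN x : cnorm (- x) = cnorm x.
Proof.
rewrite -scaleN1r cnormZr.
suff -> : modulus (-1) = 1 by rewrite mul1r.
by apply: complexI; rewrite modulusE normrN1.
Qed.

Lemma cnorm_ge0 x : 0 <= cnorm x.
Proof.
have := cnormD x (- x); rewrite subrr cnorm0 cnormN -mulr2n.
by rewrite pmulrn_lge0.
Qed.

Lemma cnorm_distrC x y : cnorm (x - y) = cnorm (y - x).
Proof. by rewrite -cnormN opprB. Qed.

Lemma cnormB x y : cnorm (x - y) <= cnorm x + cnorm y.
Proof. by rewrite -(cnormN y) cnormD. Qed.

Lemma cnorm_dist_trans y x z : cnorm (x - z) <= cnorm (x - y) + cnorm (y - z).
Proof. by rewrite -[x - z](subrKA y) cnormD. Qed.

Lemma half_addrr x : (2^-1 : R[i]) *: (x + x) = x.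
Proof.
have -> : x + x = (2%:R : R[i]) *: x by rewrite scaler_nat mulr2n.
by rewrite scalerA mulVf ?pnatr_eq0 // scale1r.
Qed.

Lemma cnorm_sum I (r : seq I) (P : pred I) (F : I -> A) :
  cnorm (\sum_(i <- r | P i) F i) <= \sum_(i <- r | P i) cnorm (F i).
Proof.
elim/big_rec2: _ => [|i y x _ le]; first by rewrite cnorm0.
by apply: le_trans (cnormD _ _) _; rewrite lerD2l.
Qed.

Lemma starD x y : star (x + y) = star x + star y.
Proof. by rewrite -[x]scale1r star_semilinear conjC1 !scale1r. Qed.

Lemma star0 : star (0 : A) = 0.
Proof. by apply: (addrI (star 0)); rewrite -starD !addr0. Qed.

Lemma starZ a x : star (a *: x) = Num.conj a *: star x.
Proof. by rewrite -[a *: x]addr0 star_semilinear star0 addr0. Qed.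

Lemma starN x : star (- x) = - star x.
Proof. by rewrite -scaleN1r starZ rmorphN1 scaleN1r. Qed.

Lemma starB x y : star (x - y) = star x - star y.
Proof. by rewrite starD starN. Qed.

Lemma star1 : star (1 : A) = 1.
Proof. by rewrite -[LHS]mulr1 -[X in _ * X]starK -starM mulr1 starK. Qed.

Lemma star_sum I (r : seq I) (P : pred I) (F : I -> A) :
  star (\sum_(i <- r | P i) F i) = \sum_(i <- r | P i) star (F i).
Proof. exact: (big_morph _ starD star0). Qed.

Lemma starX x n : star (x ^+ n) = star x ^+ n.
Proof. by elim: n => [|n IH]; rewrite ?star1 // exprS starM IH exprSr. Qed.

(** The C*-identity and submultiplicativity give |x|^2 <= |star x| |x|; apply this to
    x and to star x. *)
Lemma cnormS x : cnorm (star x) = cnorm x.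
Proof.
have le y : cnorm y <= cnorm (star y).
  have [->|nz] := eqVneq (cnorm y) 0; first exact: cnorm_ge0.
  have pos : 0 < cnorm y by rewrite lt_def nz cnorm_ge0.
  by rewrite -(ler_pM2r pos) -expr2 -cnorm_star cnormM.
by apply/eqP; rewrite eq_le le andbT -{2}[x]starK le.
Qed.

Lemma cnorm1 : cnorm (1 : A) = 1.
Proof.
have := cnorm_star (1 : A); rewrite star1 mulr1 expr2 => /eqP.
have nz : cnorm (1 : A) != 0.
  by apply/eqP => /cnorm0_eq0 /eqP; rewrite oner_eq0.
by rewrite -{1}[cnorm 1]mulr1 eq_sym (inj_eq (mulfI nz)) => /eqP.
Qed.

Lemma cnorm_isometry x : is_isometry x -> cnorm x = 1.
Proof.
move=> xx; have := cnorm_star x; rewrite xx cnorm1 => /esym/eqP.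
rewrite sqrf_eq1 => /orP[/eqP//|/eqP h].
by have := cnorm_ge0 x; rewrite h; lra.
Qed.

Lemma cnormX_le1 x n : cnorm x <= 1 -> cnorm (x ^+ n) <= 1.
Proof.
move=> x1; elim: n => [|n IH]; first by rewrite cnorm1.
rewrite exprS (le_trans (cnormM _ _)) //.
by rewrite -[leRHS]mulr1 ler_pM ?cnorm_ge0.
Qed.

Lemma cnorm_le1M x y z : cnorm x <= 1 -> cnorm z <= 1 ->
  cnorm (x * y * z) <= cnorm y.
Proof.
move=> x1 z1; rewrite (le_trans (cnormM _ _)) // -[leRHS]mulr1.
rewrite ler_pM ?cnorm_ge0 // (le_trans (cnormM _ _)) // -[leRHS]mul1r.
by rewrite ler_pM ?cnorm_ge0.
Qed.

End Basics.

(** * Limits and square roots in a C*-algebra *)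

Section Limits.
Variable R : realType.

Lemma cvg0_le (I : Type) (F : set_system I) {FF : ProperFilter F}
    (f g : I -> R) : (forall n, 0 <= f n <= g n) ->
  g n @[n --> F] --> (0 : R) -> f n @[n --> F] --> (0 : R).
Proof.
move=> fg g0; apply: (@squeeze_cvgr _ _ _ _ (fun=> 0) g) => //.
  by apply: nearW => n; apply: fg.
exact: cvg_cst.
Qed.

Lemma cvg0D (I : Type) (F : set_system I) {FF : ProperFilter F}
    (f g : I -> R) :
  f n @[n --> F] --> (0 : R) -> g n @[n --> F] --> (0 : R) ->
  (f n + g n) @[n --> F] --> (0 : R).
Proof. by move=> f0 g0; rewrite -[0 in X in _ --> X]addr0; apply: cvgD. Qed.

Lemma cvg0Z (I : Type) (F : set_system I) {FF : ProperFilter F}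
    c (f : I -> R) :
  f n @[n --> F] --> (0 : R) -> (c * f n) @[n --> F] --> (0 : R).
Proof. by move=> f0; rewrite -[0 in X in _ --> X](mulr0 c); apply: cvgMr. Qed.

Lemma cvg0P (f : nat -> R) : (forall n, 0 <= f n) ->
  f n @[n --> \oo] --> (0 : R) <->
  (forall e, 0 < e -> exists N, forall n, (N <= n)%N -> f n < e).
Proof.
move=> f0; split=> [/cvgr0Pnorm_lt h e e0|h].
  by have [N _ hN] := h _ e0; exists N => n /hN /=; rewrite ger0_norm.
apply/cvgr0Pnorm_lt => e e0; have [N hN] := h _ e0.
by exists N => // n /= /hN; rewrite ger0_norm.
Qed.

Variable A : cstarType R.
Implicit Types (x y : nat -> A) (l m : A).

Definition converges x l := cnorm (x n - l) @[n --> \oo] --> (0 : R).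

Lemma converges_cst l : converges (fun=> l) l.
Proof.
rewrite /converges; under eq_fun do rewrite subrr cnorm0; exact: cvg_cst.
Qed.

Lemma converges_unique x l m : converges x l -> converges x m -> l = m.
Proof.
move=> xl xm; apply/eqP; rewrite -subr_eq0; apply/eqP/cnorm0_eq0.
have h : (fun=> cnorm (l - m)) @ \oo --> (0 : R).
  apply: cvg0_le (cvg0D xl xm) => n.
  by rewrite cnorm_ge0 (cnorm_distrC (x n) l) cnorm_dist_trans.
by apply: cvg_unique h; [exact: Rhausdorff | exact: cvg_cst].
Qed.

Lemma converges_semilinear (c : R[i]) x y l m : converges x l ->
  converges y m -> converges (fun n => c *: x n + y n) (c *: l + m).
Proof.
move=> xl ym; apply: cvg0_le (cvg0D (cvg0Z (modulus c) xl) ym) => n.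
by rewrite cnorm_ge0 -cnormZr scalerBr opprD addrACA cnormD.
Qed.

Lemma converges_mul x y l m : converges x l ->
  converges y m -> converges (fun n => x n * y n) (l * m).
Proof.
move=> xl ym.
have xym : (cnorm (x n - l) * cnorm (y n - m)) @[n --> \oo] --> (0 : R).
  by rewrite -[0 in X in _ --> X](mulr0 0); apply: cvgM.
apply: cvg0_le (cvg0D xym (cvg0D (cvg0Z (cnorm m) xl) (cvg0Z (cnorm l) ym))).
move=> n; rewrite cnorm_ge0.
have -> : x n * y n - l * m =
    (x n - l) * (y n - m) + ((x n - l) * m + l * (y n - m)).
  rewrite addrA -mulrDr subrK mulrBl mulrBr addrA subrK //.
rewrite (le_trans (cnormD _ _)) ?lerD ?cnormM //.
by rewrite (le_trans (cnormD _ _)) ?lerD ?cnormM // mulrC cnormM.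
Qed.

Lemma converges_star x l :
  converges x l -> converges (fun n => star (x n)) (star l).
Proof.
by rewrite /converges; under [in X in _ -> X]eq_fun do rewrite -starB cnormS.
Qed.

End Limits.

Section Sqrt.
Variables (R : realType) (A : cstarType R).
Implicit Types (a g : A).

(** If 1 - g solves y = (a + y^2) / 2 then g^2 = 1 - a.  On the ball of radius |a| < 1
    this map is a contraction with ratio |a|, so its iterates from 0 converge; being
    limits of polynomials in a, they inherit self-adjointness and commute with
    whatever commutes with a. *)
Lemma sqrt_one_sub a : star a = a -> cnorm a < 1 ->
  exists g, [/\ star g = g, g * g = 1 - a &
    forall z, a * z = z * a -> g * z = z * g].
Proof.
move=> sa a1; set r := cnorm a in a1.
have r0 : 0 <= r := cnorm_ge0 a.
pose next y : A := 2^-1 *: (a + y * y).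
pose y n := iter n next 0.
have halfZ z : cnorm (2^-1 *: z : A) = 2^-1 * cnorm z.
  by rewrite cnormZr modulusV modulus_nat.
have y_le n : cnorm (y n) <= r.
  elim: n => [|n IH]; first by rewrite cnorm0.
  rewrite halfZ.
  have h1 := cnormD a (y n * y n); have h2 := cnormM (y n) (y n).
  have h3 : cnorm (y n) * cnorm (y n) <= r * 1.
    by rewrite ler_pM ?cnorm_ge0 // (le_trans IH) // ltW.
  by rewrite -/r in h1; lra.
have contr u v : cnorm u <= r -> cnorm v <= r ->
    cnorm (next u - next v) <= r * cnorm (u - v).
  move=> ur vr; rewrite -scalerBr halfZ opprD addrACA subrr add0r.
  have -> : u * u - v * v = u * (u - v) + (u - v) * v.
    by rewrite mulrBr mulrBl addrA subrK.
  have h1 := cnormD (u * (u - v)) ((u - v) * v).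
  have h2 := cnormM u (u - v); have h3 := cnormM (u - v) v.
  have h4 : cnorm u * cnorm (u - v) <= r * cnorm (u - v).
    by rewrite ler_wpM2r ?cnorm_ge0.
  have h5 : cnorm (u - v) * cnorm v <= r * cnorm (u - v).
    by rewrite mulrC ler_wpM2r ?cnorm_ge0.
  by lra.
have cau n (k : nat) : cnorm (y (n + k)%N - y n) <= r ^+ n.
  elim: n => [|n IH].
    by rewrite expr0 subr0 (le_trans (y_le _)) // ltW.
  rewrite addSn exprS (le_trans (contr _ _ (y_le _) (y_le _))) //.
  by rewrite ler_wpM2l.
have rn : r ^+ n @[n --> \oo] --> (0 : R) by apply: cvg_expr; rewrite ger0_norm.
have [l yl] : exists l, converges y l.
  apply: cnorm_complete => e e0.
  have e2 : 0 < e / 2 by rewrite divr_gt0.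
  have /cvg0P -/(_ _ _ e2)[//|N hN] := rn; first by move=> n; rewrite exprn_ge0.
  exists N => m n Nm Nn; rewrite (le_lt_trans (cnorm_dist_trans (y N) _ _)) //.
  rewrite (cnorm_distrC (y N)) -(subnKC Nm) -(subnKC Nn).
  have := hN N (leqnn N); have := cau N (m - N)%N; have := cau N (n - N)%N.
  lra.
have closed P : (forall x l', (forall n, P (x n)) -> converges x l' -> P l') ->
   P 0 -> (forall v, P v -> P (next v)) -> P l.
  move=> cP P0 Pn; apply: (cP y) => // n.
  by elim: n => [//|n /Pn].
have ynext : converges (y \o succn) l.
  by move: (yl); rewrite /converges -(cvg_shiftS (fun n => cnorm (y n - l))).
have lE : l = next l.
  have E : y \o succn = fun n => 2^-1 *: (y n * y n) + 2^-1 *: a.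
    by apply: funext => n /=; rewrite -scalerDr addrC.
  rewrite /next scalerDr addrC.
  apply: (converges_unique ynext); rewrite E.
  exact: (converges_semilinear _ (converges_mul yl yl) (converges_cst _)).
have sl : star l = l.
  apply: (closed (fun v => star v = v)) => [x l' sx xl'||v sv].
  - apply: (converges_unique _ xl').
    by have := converges_star xl'; rewrite (funext sx).
  - exact: star0.
  - by rewrite /next starZ starD starM sv sa rmorphV ?unitfE ?pnatr_eq0 // rmorph_nat.
exists (1 - l); split; first by rewrite starB star1 sl.
  rewrite mulrBr mulr1 mulrBl mul1r.
  have : l + l = a + l * l.
    have := congr1 (fun v => 2%:R *: v) lE.
    by rewrite /next scalerA mulfV ?pnatr_eq0 // scale1r scaler_nat mulr2n.
  by move=> ll; rewrite -addrA -opprD addrA ll addrK.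
move=> z az.
have lz : l * z = z * l.
  apply: (closed (fun v => v * z = z * v)) => [x l' xz xl'||v vz].
  - have h1 := converges_mul xl' (converges_cst z).
    have h2 := converges_mul (converges_cst z) xl'.
    apply: converges_unique h2.
    by move: h1; rewrite (funext xz).
  - by rewrite mulr0 mul0r.
  - rewrite /next -scalerAl -scalerAr mulrDl mulrDr az; congr (_ *: (_ + _)).
    by rewrite -mulrA vz mulrA vz mulrA.
by rewrite mulrBl mulrBr lz mul1r mulr1.
Qed.

End Sqrt.

(** * Sums of positive elements and contractivity of homomorphisms *)

Section Positivity.
Variables (R : realType) (A : cstarType R).
Implicit Types (k l q x y : A).

(** k is the real part of v = k + i l, and star v * v = k^2 + l^2 because k and l
    commute: the real part of v is no longer than v. *)
Lemma cnorm_sum_squares k l : star k = k -> star l = l -> k * l = l * k ->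
  cnorm k ^+ 2 <= cnorm (k * k + l * l).
Proof.
move=> sk sl kl; pose v : A := k + 'i *: l.
have sv : star v = k - 'i *: l by rewrite starD starZ sk sl conjCi scaleNr.
have <- : star v * v = k * k + l * l.
  rewrite sv /v mulrDr !mulrBl -!scalerAl -!scalerAr kl scalerA -['i * _]expr2 sqrCi.
  by rewrite scaleN1r opprK addrA subrK.
rewrite cnorm_star lerXn2r ?nnegrE ?cnorm_ge0 //.
have -> : k = 2^-1 *: (v + star v).
  by rewrite sv /v addrACA subrr addr0 half_addrr.
rewrite cnormZr modulusV modulus_nat; have := cnormD v (star v); rewrite cnormS.
lra.
Qed.

(** For 0 < t < 1 the element 1 - t (1 + y^2) has a square root g, so that
    t y^2 + g^2 = 1 - t and hence t |y|^2 <= 1 - t; let t tend to 1. *)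
Lemma selfadjoint_sq_eq0 y : star y = y -> cnorm (1 + y * y) <= 1 -> y = 0.
Proof.
move=> sy y1.
suff le t : 0 < t < 1 -> t * cnorm y ^+ 2 <= 1 - t.
  apply: cnorm0_eq0; have := cnorm_ge0 y; rewrite le0r => /orP[/eqP//|y0].
  have c2 : 0 < cnorm y ^+ 2 by rewrite exprn_gt0.
  have d0 : 0 < 2 + cnorm y ^+ 2 by lra.
  (* for this t the bound says 2 |y|^2 <= |y|^2 *)
  have := le (2 / (2 + cnorm y ^+ 2)).
  have tt : 0 < 2 / (2 + cnorm y ^+ 2) < 1.
    by rewrite divr_gt0 //= ltr_pdivrMr // mul1r; lra.
  move=> /(_ tt); rewrite -(ler_pM2r d0) mulrAC mulrBl mulfVK ?gt_eqF //.
  lra.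
move=> /andP[t0 t1].
pose c : R[i] := t%:C%C.
have mc : modulus c = t by rewrite modulus_real ger0_norm // ltW.
have cc : Num.conj c = c by rewrite conj_Creal // complex_real eqxx.
have s1 : star (1 + y * y) = 1 + y * y by rewrite starD star1 starM sy.
have [||g [sg gg comm]] := @sqrt_one_sub _ A (c *: (1 + y * y)).
- by rewrite starZ s1 cc.
- rewrite cnormZr mc (le_lt_trans _ t1) // -[leRHS]mulr1.
  by rewrite ler_wpM2l // ltW.
pose r : R[i] := (Num.sqrt t)%:C%C.
have rr : r * r = c by rewrite -rmorphM /= -expr2 sqr_sqrtr // ltW.
have cr : Num.conj r = r by rewrite conj_Creal // complex_real eqxx.
have mr : modulus r ^+ 2 = t.
  by rewrite modulus_real ger0_norm ?sqrtr_ge0 // sqr_sqrtr // ltW.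
have := @cnorm_sum_squares (r *: y) g; rewrite cnormZr exprMn mr.
have -> : (r *: y) * (r *: y) + g * g = (1 - t)%:C%C *: 1.
  rewrite gg -scalerAl -scalerAr scalerA rr rmorphB /= scalerBl scalerDr.
  by rewrite scale1r [c *: 1 + _]addrC opprD addrCA addNKr.
rewrite cnormZr modulus_real cnorm1 mulr1 ger0_norm; last by rewrite subr_ge0 ltW.
apply=> //; first by rewrite starZ cr sy.
rewrite -scalerAl -scalerAr; congr (_ *: _); apply/esym/comm.
by rewrite -scalerAl -scalerAr mulrDl mulrDr mul1r mulr1 mulrA.
Qed.

(** The unit is an extreme point of the unit ball: averaging the squares of 1 + y and
    1 - y leaves 1 + y^2, again of norm at most 1. *)
Lemma selfadjoint_eq0 y : star y = y -> cnorm (1 + y) <= 1 ->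
  cnorm (1 - y) <= 1 -> y = 0.
Proof.
move=> sy le1 le2; apply: selfadjoint_sq_eq0 => //.
have -> : 1 + y * y = 2^-1 *: ((1 + y) * (1 + y) + (1 - y) * (1 - y)).
  have sq z : (1 + z) * (1 + z) = 1 + z * z + (z + z) :> A.
    by rewrite mulrDl mul1r mulrDr mulr1 [z + _ * _]addrC addrACA.
  by rewrite !sq mulrNN -opprD addrACA subrr addr0 half_addrr.
rewrite cnormZr modulusV modulus_nat.
have h1 := cnormD ((1 + y) * (1 + y)) ((1 - y) * (1 - y)).
have h2 := cnormM (1 + y) (1 + y); have h3 := cnormM (1 - y) (1 - y).
have h4 : cnorm (1 + y) * cnorm (1 + y) <= 1 * 1 by rewrite ler_pM ?cnorm_ge0.
have h5 : cnorm (1 - y) * cnorm (1 - y) <= 1 * 1 by rewrite ler_pM ?cnorm_ge0.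
lra.
Qed.

(** A self-adjoint q with |1 - q| <= 1 is a positive element of norm at most 2, described
    without its spectrum, and this description passes to sums up to scaling.  So it holds
    for a small multiple of q_i and for the opposite, a multiple of the sum of the other
    q_j; the extreme point property of 1 concludes. *)
Lemma sum_positive_eq0 (I : finType) (P : pred I) (q : I -> A) :
    (forall i, P i -> star (q i) = q i) ->
    (forall i, P i -> cnorm (1 - q i) <= 1) ->
  \sum_(i | P i) q i = 0 -> forall i, P i -> q i = 0.
Proof.
move=> sq q1 q0 i Pi.
(* dividing by one more than the number of other terms leaves room for the triangle
   inequality in both estimates, also when there is no other term *)
pose m := #|[pred j | P j && (j != i)]|.
pose c : R[i] := m.+1%:R^-1.
have mc : modulus c = m.+1%:R^-1 by rewrite modulusV modulus_nat.
have c0 : c != 0 by rewrite invr_eq0 pnatr_eq0.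
have m0 : 0 < m.+1%:R^-1 :> R by rewrite invr_gt0 ltr0n.
suff cq0 : c *: q i = 0 by apply: (scalerI c0); rewrite cq0 scaler0.
have cm : m.+1%:R^-1 * m.+1%:R = 1 :> R by rewrite mulVf // pnatr_eq0.
apply: selfadjoint_eq0.
- by rewrite starZ sq // /c rmorphV ?unitfE ?pnatr_eq0 // rmorph_nat.
- have -> : 1 + c *: q i = c *: (1 + \sum_(j | P j && (j != i)) (1 - q j)).
    rewrite sumrB (_ : \sum_(j | _) q j = - q i); last first.
      by apply/eqP; rewrite -addr_eq0 addrC -bigD1 ?q0.
    rewrite opprK sumr_const addrA -mulrS scalerDr -scaler_nat scalerA.
    by rewrite mulVf ?pnatr_eq0 // scale1r.
  rewrite cnormZr mc -[leRHS]cm ler_pM2l // (le_trans (cnormD _ _)) //.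
  rewrite cnorm1 -natr1 addrC lerD2r (le_trans (cnorm_sum _ _ _)) //.
  rewrite -sumr_const ler_sum // => j /andP[Pj _]; exact: q1.
- have -> : 1 - c *: q i = c *: (m%:R *: 1 + (1 - q i)).
    rewrite addrA scalerBr; congr (_ - _).
    by rewrite -[X in _ + X]scale1r -scalerDl natr1 scalerA mulVf ?pnatr_eq0 // scale1r.
  rewrite cnormZr mc -[leRHS]cm ler_pM2l // (le_trans (cnormD _ _)) //.
  by rewrite cnormZr modulus_nat cnorm1 mulr1 -natr1 lerD2l q1.
Qed.

(** Compressing the identity sum_k T_k star(T_k) = 1 by T_j gives that the elements
    star(x_k) x_k, with x_k = star(T_k) T_j and k <> j, sum to 0.  They are
    positive: 1 - 2 P is a unitary for each projection P = T_k star(T_k). *)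
Lemma isometries_orthogonal (I : finType) (T : I -> A) :
    (forall i, is_isometry (T i)) -> \sum_i T i * star (T i) = 1 ->
  forall i j, i != j -> star (T i) * T j = 0.
Proof.
move=> isoT sumT i j ij.
pose x (m : I) := star (T m) * T j.
pose q (m : I) := 2%:R *: (star (x m) * x m).
suff : q i = 0.
  rewrite /q => /eqP; rewrite scaler_eq0 pnatr_eq0 /= => /eqP xx0.
  by apply: cnorm0_eq0; apply/eqP; rewrite -sqrf_eq0 -cnorm_star xx0 cnorm0.
apply: (@sum_positive_eq0 _ [pred k | k != j] q) => //= [m _|m _|].
- by rewrite starZ rmorph_nat starM starK.
- pose P := T m * star (T m).
  have PP : P * P = P by rewrite /P mulrA -[X in X * _]mulrA isoT mulr1.
  have sP : star P = P by rewrite starM starK.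
  have n1 : cnorm (1 - 2%:R *: P) <= 1.
    rewrite -(@expr_le1 _ 2) ?cnorm_ge0 // -cnorm_star starB star1 starZ sP rmorph_nat.
    rewrite mulrBl mul1r mulrBr mulr1 -scalerAl -scalerAr PP scalerA.
    rewrite -natrM (natrD _ 2 2) (scalerDl P 2%:R 2%:R) opprB addrK subrK.
    by rewrite cnorm1.
  have -> : 1 - q m = star (T j) * (1 - 2%:R *: P) * T j.
    rewrite mulrBr mulrBl mulr1 isoT -scalerAr -scalerAl /q /x starM starK.
    by rewrite /P !mulrA.
  by apply: le_trans n1; rewrite cnorm_le1M ?cnormS ?cnorm_isometry.
- rewrite -scaler_sumr.
  have : star (T j) * (\sum_k T k * star (T k)) * T j = 1 by rewrite sumT mulr1 isoT.
  rewrite (bigD1 j) //= mulrDr mulrDl !mulrA isoT mul1r isoT.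
  move=> /(canRL (addKr _)); rewrite addNr mulr_sumr mulr_suml => h.
  rewrite (eq_bigr (fun m => star (T j) * (T m * star (T m)) * T j)) ?h ?scaler0 //.
  by move=> m _; rewrite /x starM starK !mulrA.
Qed.

End Positivity.

Section Homs.
Variables (R : realType) (A B : cstarType R) (f : A -> B).
Hypothesis hf : star_hom f.
Implicit Types x y : A.

Lemma homL (a : R[i]) x y : f (a *: x + y) = a *: f x + f y.
Proof. by case: hf => lf _ _; rewrite lf. Qed.

Lemma homD x y : f (x + y) = f x + f y.
Proof. by rewrite -[x]scale1r homL !scale1r. Qed.

Lemma hom0 : f 0 = 0.
Proof. by apply: (addrI (f 0)); rewrite -homD !addr0. Qed.

Lemma homZ (a : R[i]) x : f (a *: x) = a *: f x.
Proof. by rewrite -[a *: x]addr0 homL hom0 addr0. Qed.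

Lemma homB x y : f (x - y) = f x - f y.
Proof. by rewrite homD -scaleN1r homZ scaleN1r. Qed.

Lemma homM x y : f (x * y) = f x * f y.
Proof. by case: hf => _ [_ mf] _; rewrite mf. Qed.

Lemma hom1 : f 1 = 1.
Proof. by case: hf => _ []. Qed.

Lemma homS x : f (star x) = star (f x).
Proof. by case: hf. Qed.

Lemma homX x n : f (x ^+ n) = f x ^+ n.
Proof. by elim: n => [|n IH]; rewrite ?expr0 ?hom1 // !exprS homM IH. Qed.

(** After scaling, |h| < 1 and h^2 + g^2 = 1 for some self-adjoint g commuting with h.
    A homomorphism preserves this identity, which bounds the norm of the image of h. *)
Lemma hom_selfadjoint_le (h : A) : star h = h -> cnorm (f h) <= cnorm h.
Proof.
move=> sh; apply/ler_addgt0Pl => e e0.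
have r0 : 0 < e + cnorm h by have := cnorm_ge0 h; lra.
pose c : R[i] := ((e + cnorm h)^-1)%:C%C.
have mc : modulus c = (e + cnorm h)^-1.
  by rewrite modulus_real ger0_norm // invr_ge0 ltW.
have cc : Num.conj c = c by rewrite conj_Creal // complex_real eqxx.
have sk : star (c *: h) = c *: h by rewrite starZ sh cc.
have k1 : cnorm (c *: h) < 1.
  by rewrite cnormZr mc mulrC ltr_pdivrMr // mul1r ltrDr.
have [||g [sg gg comm]] := @sqrt_one_sub _ A ((c *: h) * (c *: h)).
- by rewrite starM sk.
- rewrite (le_lt_trans (cnormM _ _)) // -expr2 expr_lt1 ?cnorm_ge0 //.
have := @cnorm_sum_squares _ B (f (c *: h)) (f g).
rewrite -!homM -homD gg addrC subrK hom1 cnorm1 -!homS sk sg.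
rewrite comm ?mulrA // => /(_ erefl erefl erefl).
rewrite expr_le1 ?cnorm_ge0 // homZ cnormZr mc mulrC ler_pdivrMr //.
by rewrite mul1r.
Qed.

(** The C*-identity reduces the claim to the self-adjoint element star x * x. *)
Lemma hom_contractive (x : A) : cnorm (f x) <= cnorm x.
Proof.
rewrite -(@ler_pXn2r _ 2) ?nnegrE ?cnorm_ge0 // -!cnorm_star -homS -homM.
by apply: hom_selfadjoint_le; rewrite starM starK.
Qed.

Lemma hom_converges (x : nat -> A) (l : A) : converges x l -> converges (f \o x) (f l).
Proof.
by move=> xl; apply: cvg0_le xl => n /=; rewrite cnorm_ge0 -homB hom_contractive.
Qed.

End Homs.

(** * Closed subspaces and powers of a unitary *)

Section ClosedSubspaces.
Variables (R : realType) (A : cstarType R).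

Definition closed_subspace (G : set A) :=
  [/\ G 0, forall (a : R[i]) x y, G x -> G y -> G (a *: x + y) &
      forall x l, (forall n, G (x n)) -> converges x l -> G l].

Lemma closed_subspaceD G x y : closed_subspace G -> G x -> G y -> G (x + y).
Proof. by case=> _ GL _ Gx Gy; rewrite -[x]scale1r; apply: GL. Qed.

Lemma closed_subspaceZ G (a : R[i]) x : closed_subspace G -> G x -> G (a *: x).
Proof. by case=> G0 GL _ Gx; rewrite -[_ *: _]addr0; apply: GL. Qed.

Lemma closed_subspace_sum G I (r : seq I) (P : pred I) (F : I -> A) :
  closed_subspace G -> (forall i, P i -> G (F i)) -> G (\sum_(i <- r | P i) F i).
Proof.
move=> cG GF; elim/big_rec: _ => [|i x /GF Gi Gx]; first by case: cG.
exact: closed_subspaceD.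
Qed.

(** The convergence arguments below are all of this shape: to see that uniformly bounded
    linear maps tend pointwise to 0 it suffices to check a set with dense span. *)
Lemma vanishing_closed_subspace (D : nat -> A -> A) (c : R) :
    (forall n (a : R[i]) x y, D n (a *: x + y) = a *: D n x + D n y) ->
    (forall n x, cnorm (D n x) <= c * cnorm x) ->
  closed_subspace [set v | cnorm (D n v) @[n --> \oo] --> (0 : R)].
Proof.
move=> DL Dc.
have D0 n : D n 0 = 0.
  by have := DL n 1 0 0; rewrite !scale1r addr0 -{1}[D n 0]addr0 => /addrI.
split=> /= [|a x y Dx Dy|x l Dx xl].
- rewrite (_ : (fun n => _) = fun=> 0); first exact: cvg_cst.
  by apply: funext => n; rewrite D0 cnorm0.
- apply: cvg0_le (cvg0D (cvg0Z (modulus a) Dx) Dy) => n.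
  by rewrite cnorm_ge0 DL -cnormZr cnormD.
- apply/cvg0P => [n|e e0]; first exact: cnorm_ge0.
  have c0 : 0 < `|c| + 1 by rewrite ltr_wpDl.
  have e1 : 0 < e / 2 / (`|c| + 1) by rewrite !divr_gt0.
  have /cvg0P -/(_ (fun=> cnorm_ge0 _) _ e1)[N /(_ N (leqnn N)) hN] := xl.
  have e2 : 0 < e / 2 by rewrite divr_gt0.
  have /cvg0P -/(_ (fun=> cnorm_ge0 _) _ e2)[K hK] := Dx N.
  exists K => n Kn.
  have -> : l = (-1) *: (x N - l) + x N by rewrite scaleN1r opprB subrK.
  rewrite DL (le_lt_trans (cnormD _ _)) // cnormZr.
  have -> : modulus (-1 : R[i]) = 1 by apply: complexI; rewrite modulusE normrN1.
  rewrite mul1r; have := hK n Kn; have := Dc n (x N - l).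
  have h : c * cnorm (x N - l) <= (`|c| + 1) * cnorm (x N - l).
    by rewrite ler_wpM2r ?cnorm_ge0 // (le_trans (ler_norm c)) // lerDl.
  move: hN; rewrite ltr_pdivlMr // mulrC; lra.
Qed.

End ClosedSubspaces.

Section UnitaryPowers.
Variables (R : realType) (A : cstarType R) (u : A).
Hypothesis uu : is_unitary u.

Definition upow (c : int) : A :=
  match c with Posz n => u ^+ n | Negz n => star u ^+ n.+1 end.

Lemma upowS c : upow (1 + c) = u * upow c.
Proof.
case: uu => uV Vu; case: c => [n|[|n]]; first by rewrite /= exprS.
  by rewrite /= expr1 Vu.
have -> : 1 + Negz n.+1 = Negz n by rewrite !NegzE; lia.
by rewrite /= [in RHS]exprS mulrA Vu mul1r.
Qed.

Lemma upowP c : upow (- 1 + c) = star u * upow c.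
Proof.
case: uu => uV Vu.
by rewrite -[in RHS](subrKC 1 c) upowS mulrA uV mul1r addrC.
Qed.

Lemma upowD c d : upow (c + d) = upow c * upow d.
Proof.
elim/int_rect: c => [|n IH|n IH]; first by rewrite add0r mul1r.
  by rewrite -addn1 PoszD [n%:Z + 1]addrC -addrA !upowS IH mulrA.
by rewrite -addn1 PoszD [n%:Z + 1]addrC opprD -addrA !upowP IH mulrA.
Qed.

Lemma upow0 : upow 0 = 1.
Proof. by []. Qed.

Lemma upow1 : upow 1 = u.
Proof. by []. Qed.

Lemma star_upow c : star (upow c) = upow (- c).
Proof.
case: c => [[|n]|n]; first by rewrite oppr0 star1.
  by rewrite -NegzE /upow starX.
by rewrite NegzE opprK /upow starX starK.
Qed.

Lemma upow_unitary c : is_unitary (upow c).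
Proof. by split; rewrite star_upow -upowD ?addNr ?subrr. Qed.

Lemma cnorm_upow c : cnorm (upow c) = 1.
Proof. by apply: cnorm_isometry; case: (upow_unitary c). Qed.

End UnitaryPowers.

(** * Consequences of the defining relations *)

Section Relations.
Variables (R : realType) (p : nat) (A : cstarType R) (u s : A).
Hypothesis hp : (2 <= p)%N.
Hypothesis rel : Qp_relations p u s.

Local Notation U := (upow u).
Local Notation T := (@cuntz_gen _ p _ u s).

Lemma Qp_unitary : is_unitary u. Proof. by case: rel. Qed.
Lemma Qp_isometry : star s * s = 1. Proof. by case: rel. Qed.

Lemma cuntz_genE (i : 'I_p) : T i = U i * s. Proof. by []. Qed.

Lemma mul_s_upow c : s * U c = U (p%:Z * c) * s.
Proof.
have D := upowD Qp_unitary; case: (rel) => [[uV Vu] _ su _].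
have sV : s * star u = star (u ^+ p) * s.
  have [pV Vp] := upow_unitary Qp_unitary p.
  by rewrite -[LHS]mul1r -pV -mulrA [upow _ _ * _]mulrA -su -!mulrA Vu mulr1.
elim/int_rect: c => [|n IH|n IH]; first by rewrite mulr0 mulr1 mul1r.
  rewrite -addn1 PoszD mulrDr !D mulrA IH -!mulrA; congr (_ * _).
  by rewrite mulr1.
rewrite -addn1 PoszD opprD mulrDr !D mulrA IH -!mulrA; congr (_ * _).
by rewrite mulrN1 -(star_upow u p%:Z).
Qed.

Lemma mul_sX_upow m c : s ^+ m * U c = U ((p ^ m)%:Z * c) * s ^+ m.
Proof.
elim: m c => [|m IH] c; first by rewrite expn0 !mul1r mulr1.
by rewrite exprS -mulrA IH mulrA mul_s_upow -mulrA expnS PoszM (mulrA p%:Z).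
Qed.

Lemma mul_upow_starsX m c :
  U c * star s ^+ m = star s ^+ m * U ((p ^ m)%:Z * c).
Proof.
apply: (can_inj (@starK _ A)); rewrite !starM -!starX !starK !star_upow.
by rewrite mul_sX_upow mulrN.
Qed.

Lemma mul_upow_stars c : U c * star s = star s * U (p%:Z * c).
Proof. by have := mul_upow_starsX 1 c; rewrite expn1. Qed.

Lemma cuntz_gen_isometry i : is_isometry (T i).
Proof.
have [iV _] := upow_unitary Qp_unitary i.
rewrite /is_isometry cuntz_genE starM -mulrA [_ * (U i * s)]mulrA iV mul1r.
exact: Qp_isometry.
Qed.

Lemma cuntz_sum : \sum_i T i * star (T i) = 1.
Proof.
case: rel => _ _ _ <-; apply: eq_bigr => i _.
by rewrite /cuntz_gen starM starX !mulrA.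
Qed.

Lemma cuntz_gen_orthogonal i j : star (T i) * T j = (i == j)%:R.
Proof.
have [->|ij] := eqVneq i j; first exact: cuntz_gen_isometry.
exact: isometries_orthogonal cuntz_gen_isometry cuntz_sum _ _ ij.
Qed.

(** Write c = q p + r with 0 <= r < p.  Then U c s = U r s U q, and star s U r s vanishes
    unless r = 0, by the orthogonality of the isometries T_0 and T_r. *)
Lemma compress_upow c :
  star s * U c * s = if (p%:Z %| c)%Z then U (c %/ p%:Z)%Z else 0.
Proof.
have p0 : p%:Z != 0 by lia.
have D := upowD Qp_unitary.
have r0 : 0 <= (c %% p%:Z)%Z by rewrite modz_ge0.
have [r rE] : exists r : nat, (c %% p%:Z)%Z = r.
  by exists `|(c %% p%:Z)%Z|%N; rewrite gez0_abs.
have rp : (r < p)%N by have := ltz_pmod c (_ : 0 < p%:Z); lia.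
have h0 : (0 < p)%N by lia.
have orth : star s * U r * s = (r == 0)%:R.
  have := cuntz_gen_orthogonal (Ordinal h0) (Ordinal rp).
  by rewrite !cuntz_genE /= mul1r -(inj_eq val_inj) /= eq_sym mulrA.
rewrite {1}(divz_eq c p%:Z) rE addrC mulrC D mulrA -!mulrA -mul_s_upow.
rewrite !mulrA orth; case: ifP => /= [/dvdz_mod0P|/dvdz_mod0P nd].
  by rewrite rE => /eqP; rewrite eqz_nat => ->; rewrite mul1r.
by rewrite (_ : (r == 0)%N = false) ?mul0r //; apply/eqP => r00; rewrite rE r00 in nd.
Qed.

End Relations.

(** * A dense subspace and its induction principle *)

Section Density.
Variables (R : realType) (p : nat) (A : cstarType R) (u s : A).
Hypothesis hp : (2 <= p)%N.
Hypothesis rel : Qp_relations p u s.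
Hypothesis gen : cstar_gen [set u; s] = setT.

Local Notation U := (upow u).
Local Notation T := (@cuntz_gen _ p _ u s).

(** The smallest closed subspace G0 containing these products is stable under left
    multiplication by u, s and their adjoints, so the elements x such that x and star x
    multiply G0 into itself form a C*-subalgebra; as it contains u and s it contains
    every x, and x = x * 1 lies in G0. *)
Lemma Qp_density (G : set A) : closed_subspace G ->
  (forall a m n b, G (U a * s ^+ m * star s ^+ n * U b)) -> forall x, G x.
Proof.
move=> cG GM.
pose good (H : set A) := closed_subspace H /\
  forall a m n b, H (U a * s ^+ m * star s ^+ n * U b).
pose G0 : set A := [set v | forall H, good H -> H v].
have G0M a m n b : G0 (U a * s ^+ m * star s ^+ n * U b) by move=> H [].
have cG0 : closed_subspace G0.
  split=> [H [[]//]|a x y Gx Gy H gH|x l Gx xl H gH]; case: (gH) => [[_ HL HC] _].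
    by apply: HL; [exact: Gx | exact: Gy].
  by apply: HC xl => n; apply: Gx.
have stable t : (forall a m n b, G0 (t * (U a * s ^+ m * star s ^+ n * U b))) ->
    forall v, G0 v -> G0 (t * v).
  move=> Gt v Gv; apply: (Gv [set w | G0 (t * w)]); split=> //.
  split=> [|a x y /= Gx Gy|x l /= Gx xl].
  - by rewrite /= mulr0; case: cG0.
  - by rewrite mulrDr -scalerAr; case: cG0 => _ + _; apply.
  - case: cG0 => _ _; apply; first exact: Gx.
    exact: converges_mul (converges_cst t) xl.
have D := upowD (Qp_unitary rel).
have stU c v : G0 v -> G0 (U c * v).
  apply: stable => a m n b; rewrite !mulrA -D; exact: G0M.
have sts v : G0 v -> G0 (s * v).
  apply: stable => a m n b.
  by rewrite !mulrA (mul_s_upow rel) -[U _ * s * _]mulrA -exprS; exact: G0M.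
have stV v : G0 v -> G0 (star s * v).
  apply: stable => a [|m] n b.
    rewrite mulr1 (mul_upow_starsX rel) !mulrA -exprS -mulrA -D.
    by have := G0M 0 0%N n.+1 ((p ^ n)%:Z * a + b); rewrite !mul1r.
  rewrite exprS !mulrA (compress_upow hp rel); case: ifP => _; first exact: G0M.
  by rewrite !mul0r; case: cG0.
pose L : set A := [set x | forall v, G0 v -> G0 (x * v) /\ G0 (star x * v)].
have cL : cstar_subalgebra L.
  split=> [v Gv|a x y Lx Ly v Gv|x y Lx Ly v Gv|x Lx v Gv|x l Lx xl].
  - by rewrite star0 mul0r; case: cG0.
  - have [h1 h2] := Lx v Gv; have [h3 h4] := Ly v Gv.
    rewrite star_semilinear !mulrDl -!scalerAl.
    by case: cG0 => _ h _; split; apply: h.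
  - rewrite starM -!mulrA; split; first by apply: (Lx _ _).1; apply: (Ly _ _).1.
    by apply: (Ly _ _).2; apply: (Lx _ _).2.
  - by rewrite starK; have [] := Lx v Gv.
  - move=> v Gv; split; case: cG0 => _ _; apply.
    + by move=> n; apply: (Lx n v Gv).1.
    + exact: converges_mul xl (converges_cst v).
    + by move=> n; apply: (Lx n v Gv).2.
    + exact: converges_mul (converges_star xl) (converges_cst v).
have all_L x : L x.
  have : cstar_gen [set u; s] x by rewrite gen.
  apply; split=> // y [->|->] v Gv; last by split; [exact: sts | exact: stV].
  by split; [exact: (stU 1) | exact: (stU (-1))].
move=> x; have [+ _] := all_L x _ (G0M 0 0%N 0%N 0).
rewrite !mulr1; apply; split=> //.
Qed.

Lemma int_digit (c : int) : exists q (i : 'I_p), c = q * p%:Z + i%:Z.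
Proof.
have [r rE] : exists r : nat, (c %% p%:Z)%Z = r.
  by exists `|(c %% p%:Z)%Z|%N; rewrite gez0_abs // modz_ge0 //; lia.
have rp : (r < p)%N by have := ltz_pmod c (_ : 0 < p%:Z); lia.
by exists (c %/ p%:Z)%Z, (Ordinal rp); rewrite {1}(divz_eq c p%:Z) rE.
Qed.

(** Writing a and - b in base p peels off one factor T_i on the left and one star(T_j) on
    the right of U a s^m star(s)^n U b as long as m and n are both positive.  The two
    remaining families are the ones that the averaging maps below treat by hand. *)
Lemma Qp_ind (G : set A) : closed_subspace G ->
    (forall c r, G (U c * s ^+ r)) -> (forall c r, G (star s ^+ r * U c)) ->
    (forall i j v, G v -> G (T i * v * star (T j))) ->
  forall x, G x.
Proof.
move=> cG Gl Gr Gs; apply: Qp_density => // a m n b.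
have D := upowD (Qp_unitary rel).
elim: m n a b => [|m IH] [|n] a b.
- by have := Gl (a + b) 0%N; rewrite !mulr1 D.
- by rewrite mulr1 (mul_upow_starsX rel) -mulrA -D; apply: Gr.
- by rewrite mulr1 -mulrA (mul_sX_upow rel) mulrA -D; apply: Gl.
have [q [i ->]] := int_digit a; have [r [j bE]] := int_digit (- b).
have -> : b = p%:Z * (- r) - j%:Z by lia.
have := Gs i j _ (IH n q (- r)); rewrite !cuntz_genE starM star_upow.
congr G; rewrite -!mulrA.
rewrite [U (- r) * _]mulrA (mul_upow_stars rel) -mulrA -D.
rewrite [s * (U q * _)]mulrA (mul_s_upow rel) !mulrA -D exprS exprSr.
by rewrite [q * _]mulrC [_ + i%:Z]addrC !mulrA.
Qed.

End Density.

(** * Rigidity: commuting with s and fixing u s *)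

Section Rigidity.
Variables (R : realType) (p : nat) (A : cstarType R) (u s : A).
Hypothesis hp : (2 <= p)%N.
Hypothesis rel : Qp_relations p u s.
Hypothesis gen : cstar_gen [set u; s] = setT.

Local Notation U := (upow u).
Local Notation T := (@cuntz_gen _ p _ u s).

Lemma starX_mulX m n : (m <= n)%N -> star s ^+ m * s ^+ n = s ^+ (n - m).
Proof.
move=> mn; rewrite -{1}(subnKC mn); move: (n - m)%N => d.
elim: m {mn} => [|m IH]; first by rewrite mul1r.
by rewrite exprSr addSn exprS -mulrA [star s * _]mulrA (Qp_isometry rel) mul1r.
Qed.

(** Each compression by s divides the exponent by p or kills the element, and a nonzero
    integer c cannot be divided by p more than |c| times. *)
Lemma compressX_upow n c : c != 0 -> (`|c| <= n)%N ->
  star s ^+ n * U c * s ^+ n = 0.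
Proof.
elim: n c => [|n IH] c c0 cn; first by lia.
rewrite exprSr exprS -!mulrA [U c * _]mulrA [star s * _]mulrA [star s * _]mulrA.
rewrite (compress_upow hp rel); case: ifP => [/dvdzP[q cE]|_]; last first.
  by rewrite mul0r mulr0.
have q0 : q != 0 by apply: contraNneq c0 => q0; rewrite cE q0 mul0r.
rewrite cE mulzK; last by lia.
rewrite mulrA; apply: IH => //; move: cn; rewrite cE abszM.
have : (0 < `|q|)%N by rewrite absz_gt0.
by move=> q1 cn; nia.
Qed.

(** The isometry u s has range orthogonal to that of s, so its translates by s have
    pairwise orthogonal ranges. *)
Definition wandering k := s ^+ k * (u * s).

Lemma shifted_orthogonal j k : star (wandering j) * wandering k = (j == k)%:R.
Proof.
have us : star (u * s) * (u * s) = 1.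
  have [uV _] := Qp_unitary rel; rewrite starM -mulrA [star u * _]mulrA uV mul1r.
  exact: Qp_isometry rel.
have lt a b : (a < b)%N -> star (wandering a) * wandering b = 0.
  move=> ab; rewrite /wandering starM starX -mulrA [star s ^+ a * _]mulrA.
  rewrite starX_mulX 1?ltnW // -(subnSK ab) exprS starM -!mulrA.
  rewrite [star u * _]mulrA [star s * _]mulrA [star s * _]mulrA.
  have -> : star u = U (- 1) by [].
  by rewrite (compress_upow hp rel) ifN ?mul0r // dvdzE /= dvdn1; lia.
case: (ltngtP j k) => [/lt //|kj|->].
  by rewrite -[LHS]starK starM starK lt // star0.
rewrite /wandering starM starX -mulrA [star s ^+ k * _]mulrA starX_mulX //.
by rewrite subnn mul1r.
Qed.

(** The power of s on the right brings every term to the same degree n in s; this makes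
    the mean below act on the powers of s as the Fejer kernel. *)
Definition fejer_vector n := \sum_(k < n.+1) wandering k * s ^+ (n - k).

Definition fejer_mean n v :=
  (n.+1%:R^-1 : R[i]) *: (star (fejer_vector n) * v * fejer_vector n).

(** Only the pairs of terms whose indices differ by r survive, and there are n + 1 - r of
    them.  The case r = 0 says that the vector has norm (n + 1)^(1/2). *)
Lemma fejer_moment n r :
  star (fejer_vector n) * s ^+ r * fejer_vector n = (n.+1 - r)%:R *: s ^+ r.
Proof.
transitivity (\sum_(k < n.+1 | (k < n.+1 - r)%N) s ^+ r); last first.
  rewrite -(big_ord_widen _ (fun=> s ^+ r) (leq_subr r n.+1)).
  by rewrite sumr_const card_ord scaler_nat.
rewrite -mulrA mulr_sumr mulr_sumr [RHS]big_mkcond /=; apply: eq_bigr => k _.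
have -> : s ^+ r * (wandering k * s ^+ (n - k)) = wandering (r + k)%N * s ^+ (n - k).
  by rewrite /wandering !mulrA -exprD.
rewrite /fejer_vector star_sum mulr_suml.
have E (j : 'I_n.+1) :
    star (wandering j * s ^+ (n - j)) * (wandering (r + k)%N * s ^+ (n - k)) =
    if j == (r + k)%N :> nat then star s ^+ (n - j) * s ^+ (n - k) else 0.
  rewrite starM starX -mulrA [star (wandering j) * _]mulrA shifted_orthogonal.
  by case: eqP; rewrite ?mul1r ?mul0r ?mulr0.
rewrite (eq_bigr _ (fun j _ => E j)) -big_mkcond /=.
have -> : (k < n.+1 - r)%N = (r + k < n.+1)%N by rewrite ltn_subRL.
case: ifP => [lt|ge].
  rewrite (big_pred1 (Ordinal lt)) // starX_mulX; last by rewrite leq_sub2l ?leq_addl.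
  by congr (_ ^+ _); move: lt => /=; lia.
by rewrite big_pred0 // => j; apply/eqP => jE; move: ge; rewrite -jE ltn_ord.
Qed.

Lemma fejer_contractive n v : cnorm (fejer_mean n v) <= cnorm v.
Proof.
have BB : cnorm (fejer_vector n) ^+ 2 = n.+1%:R.
  rewrite -cnorm_star; have := fejer_moment n 0; rewrite mulr1 subn0 => ->.
  by rewrite cnormZr cnorm1 modulus_nat mulr1.
rewrite cnormZr modulusV modulus_nat mulrC ler_pdivrMr ?ltr0n //.
rewrite (le_trans (cnormM _ _)) // -BB expr2 mulrA ler_wpM2r ?cnorm_ge0 //.
by rewrite (le_trans (cnormM _ _)) // cnormS mulrC.
Qed.

(** The offset m in the exponent makes the statement that all these defects vanish in the
    limit, for every m, stable under v |-> T_i v star(T_j), which costs one compression. *)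
Definition fejer_defect m n v := fejer_mean n (star s ^+ (n - m) * v * s ^+ (n - m)) -
  star s ^+ (n - m) * v * s ^+ (n - m).

Lemma defectL m n (a : R[i]) x y :
  fejer_defect m n (a *: x + y) = a *: fejer_defect m n x + fejer_defect m n y.
Proof.
rewrite /fejer_defect /fejer_mean !(mulrDr, mulrDl, scalerDr).
rewrite -!(scalerAr, scalerAl) scalerN.
rewrite opprD addrACA; congr (_ - _ + _).
by rewrite !scalerA mulrC.
Qed.

Lemma defect_le m n v : cnorm (fejer_defect m n v) <= 2 * cnorm v.
Proof.
have le : cnorm (star s ^+ (n - m) * v * s ^+ (n - m)) <= cnorm v.
  rewrite cnorm_le1M // cnormX_le1 // ?cnormS cnorm_isometry //;
    exact: (Qp_isometry rel).
have := fejer_contractive n (star s ^+ (n - m) * v * s ^+ (n - m)).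
have := cnormB (fejer_mean n (star s ^+ (n - m) * v * s ^+ (n - m)))
  (star s ^+ (n - m) * v * s ^+ (n - m)).
rewrite -/(fejer_defect m n v); lra.
Qed.

Lemma defect_star m n v : fejer_defect m n (star v) = star (fejer_defect m n v).
Proof.
have sn : Num.conj (n.+1%:R^-1) = n.+1%:R^-1 :> R[i].
  by rewrite rmorphV ?unitfE ?pnatr_eq0 // rmorph_nat.
by rewrite /fejer_defect /fejer_mean starB starZ sn !starM !starX !starK !mulrA.
Qed.

(** Compression by s^n turns U c s^r into 0 as soon as n exceeds |c| > 0, and fixes s^r,
    on which the Fejer mean differs from the identity by the factor r / (n + 1)
    for large n. *)
Lemma defect_vanishes v m : cnorm (fejer_defect m n v) @[n --> \oo] --> (0 : R).
Proof.
pose G : set A :=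
  [set v | forall m, cnorm (fejer_defect m n v) @[n --> \oo] --> (0 : R)].
suff: G v by apply.
have cG : closed_subspace G.
  have c k := vanishing_closed_subspace (@defectL k) (@defect_le k).
  split=> [k|a x y Gx Gy k|x l Gx xl k]; have [h0 hL hC] := c k.
  - exact: h0.
  - exact: (hL a x y (Gx k) (Gy k)).
  - exact: (hC x l (fun n => Gx n k) xl).
have base c r : G (U c * s ^+ r).
  move=> k; have [->|c0] := eqVneq c 0.
    apply: cvg0_le (cvg0Z r%:R (@cvg_harmonic R)) => n.
    rewrite cnorm_ge0 mul1r /fejer_defect -mulrA -exprD starX_mulX ?leq_addl // addnK.
    rewrite /fejer_mean fejer_moment scalerA -[X in _ - X]scale1r -scalerBl cnormZr.
    have -> : n.+1%:R^-1 * (n.+1 - r)%:R - 1 =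
        - (n.+1%:R^-1 * (minn n.+1 r)%:R) :> R[i].
      rewrite -[X in _ - X](@mulVf _ n.+1%:R) ?pnatr_eq0 // -mulrBr -mulrN.
      congr (_ * _).
      rewrite -[X in _ - X%:R](_ : (n.+1 - r + minn n.+1 r)%N = _); last by lia.
      by rewrite natrD opprD addNKr.
    rewrite modulusN modulusM modulusV !modulus_nat -mulrA mulrC /harmonic.
    rewrite ler_wpM2r ?invr_ge0 // -[leRHS]mulr1 ler_pM ?ler0n ?cnorm_ge0 //.
      by rewrite ler_nat geq_minr.
    by rewrite cnormX_le1 // cnorm_isometry //; apply: (Qp_isometry rel).
  apply/cvg0P => [n|e e0]; first exact: cnorm_ge0.
  exists (`|c| + k)%N => n hn; rewrite /fejer_defect.
  have -> : star s ^+ (n - k) * (U c * s ^+ r) * s ^+ (n - k) = 0.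
    rewrite mulrA -mulrA -exprD addnC exprD mulrA compressX_upow ?mul0r //.
    by rewrite leq_subRL; lia.
  by rewrite /fejer_mean mulr0 mul0r scaler0 subr0 cnorm0.
apply: (Qp_ind hp rel gen cG base) => [c r k|i j x Gx k].
  have -> : star s ^+ r * U c = star (U (- c) * s ^+ r).
    by rewrite starM starX star_upow opprK.
  under eq_fun do rewrite defect_star cnormS.
  exact: base.
have h0 : (0 < p)%N by lia.
have sT l : star s * T l = (l == Ordinal h0)%:R.
  have T0 : T (Ordinal h0) = s by rewrite cuntz_genE mul1r.
  by rewrite -{1}T0 (cuntz_gen_orthogonal rel) eq_sym.
apply/cvg0P => [n|e e0]; first exact: cnorm_ge0.
have /cvg0P -/(_ (fun=> cnorm_ge0 _) _ e0)[N hN] := Gx k.+1.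
(* one of the n - k compressions is spent on the outer factors *)
exists (maxn N k.+1) => n; rewrite geq_max => /andP[Nn kn].
apply: le_lt_trans (hN n Nn); rewrite /fejer_defect -(subnSK kn) exprSr exprS.
have -> : star s ^+ (n - k.+1) * star s * (T i * x * star (T j)) *
    (s * s ^+ (n - k.+1)) = star s ^+ (n - k.+1) *
    ((star s * T i) * x * star (star s * T j)) * s ^+ (n - k.+1).
  by rewrite (starM (star s)) starK !mulrA.
rewrite !sT; do 2!case: eqP => _; rewrite ?star1 ?star0 ?mul1r ?mulr1 ?mul0r ?mulr0 //.
- by rewrite /fejer_mean mul0r mulr0 mul0r scaler0 subr0 cnorm0 cnorm_ge0.
- by rewrite mul0r /fejer_mean mulr0 mul0r scaler0 subr0 cnorm0 cnorm_ge0.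
- by rewrite mul0r /fejer_mean mulr0 mul0r scaler0 subr0 cnorm0 cnorm_ge0.
Qed.

(** Such an x is fixed by the compressions by s^n, and since it fixes every wandering
    isometry its Fejer means are all equal to 1; by the previous convergence, x = 1.
    On l^2(Z) the operators that are scalar on the basis vector of index 0 and the
    identity on the other basis vectors satisfy both hypotheses: the density of the
    polynomials in u and s is what excludes them. *)
Lemma shift_commutant_trivial x : s * x = x * s -> x * (u * s) = u * s -> x = 1.
Proof.
move=> sx xus.
have sX n : s ^+ n * x = x * s ^+ n by apply/esym/commrX/esym.
have xB n : x * fejer_vector n = fejer_vector n.
  rewrite mulr_sumr; apply: eq_bigr => k _.
  by rewrite /wandering mulrA mulrA -sX -[_ * x * _]mulrA xus.
have D1 n : fejer_defect 0 n x = 1 - x.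
  rewrite /fejer_defect subn0 -mulrA -sX mulrA starX_mulX // subnn mul1r.
  rewrite /fejer_mean -mulrA xB.
  have := fejer_moment n 0; rewrite mulr1 subn0 => ->.
  by rewrite scalerA mulVf ?pnatr_eq0 // scale1r.
apply/esym/(converges_unique (converges_cst 1)).
have := defect_vanishes x 0; rewrite (_ : (fun n => _) = (fun=> cnorm (1 - x))) //.
by apply: funext => n; rewrite D1.
Qed.

End Rigidity.

(** * Uniqueness of extensions *)

Section HomsOnQp.
Variables (R : realType) (p : nat) (Q : cstarType R) (u s : Q).
Hypothesis hp : (2 <= p)%N.
Hypothesis rel : Qp_relations p u s.
Hypothesis gen : cstar_gen [set u; s] = setT.

Local Notation U := (upow u).
Local Notation T := (@cuntz_gen _ p _ u s).

Lemma star_hom_id : star_hom (@id Q).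
Proof. by split. Qed.

Lemma star_hom_comp (A B C : cstarType R) (g : B -> C) (f : A -> B) :
  star_hom g -> star_hom f -> star_hom (g \o f).
Proof.
move=> hg hf; split=> [a x y||x] /=; first by rewrite (homL hf) (homL hg).
  by split=> [|x y] /=; rewrite ?(hom1 hf) ?(hom1 hg) ?(homM hf) ?(homM hg).
by rewrite (homS hf) (homS hg).
Qed.

Lemma star_hom_inv (A B : cstarType R) (f : A -> B) (g : B -> A) :
  star_hom f -> cancel f g -> cancel g f -> star_hom g.
Proof.
move=> hf fg gf; split=> [a x y||x].
- by apply: (can_inj fg); rewrite (homL hf) !gf.
- by split=> [|x y]; apply: (can_inj fg); rewrite ?(hom1 hf) ?(homM hf) !gf.
- by apply: (can_inj fg); rewrite (homS hf) !gf.
Qed.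

Lemma star_hom_eq (B : cstarType R) (f g : Q -> B) : star_hom f -> star_hom g ->
  f u = g u -> f s = g s -> f =1 g.
Proof.
move=> hf hg fgu fgs x.
have : cstar_gen [set u; s] x by rewrite gen.
move/(_ [set y | f y = g y]); apply; split=> [|y [->|->] //].
split=> /= [|a y z fy fz|y z fy fz|y fy|y l fy yl].
- by rewrite (hom0 hf) (hom0 hg).
- by rewrite (homL hf) (homL hg) fy fz.
- by rewrite (homM hf) (homM hg) fy fz.
- by rewrite (homS hf) (homS hg) fy.
- apply: (converges_unique (hom_converges hf yl)).
  have := hom_converges hg yl; rewrite (_ : g \o y = f \o y) //.
  by apply: funext => n /=; rewrite fy.
Qed.

(** From u T_i = T_(i+1) for i < p - 1 and u T_(p-1) = s u one finds that
    x = chi(u) star(u) commutes with s and fixes u s, whence chi(u) = u. *)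
Lemma star_hom_fix_cuntz (chi : Q -> Q) : star_hom chi ->
  (forall i, chi (T i) = T i) -> chi =1 id.
Proof.
move=> hchi chiT; have [uV Vu] := Qp_unitary rel.
have chis : chi s = s.
  have h0 : (0 < p)%N by lia.
  by have := chiT (Ordinal h0); rewrite cuntz_genE /= mul1r.
have chius : chi u * s = u * s.
  have h1 : (1 < p)%N by [].
  by have := chiT (Ordinal h1); rewrite cuntz_genE /= (homM hchi) chis.
have chiu : chi u = u.
  suff : chi u * star u = 1.
    by move/(congr1 ( *%R^~ u)); rewrite -mulrA uV mulr1 mul1r.
  apply: (shift_commutant_trivial hp rel gen); last first.
    by rewrite -mulrA [star u * _]mulrA uV mul1r.
  have hl : (p.-1 < p)%N by lia.
  have := chiT (Ordinal hl) => /(congr1 ( *%R (chi u))).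
  have pE : u * (u ^+ p.-1 * s) = s * u.
    case: rel => _ _ -> _; rewrite mulrA -exprS prednK //; lia.
  rewrite /cuntz_gen /= -(homM hchi) pE (homM hchi) chis => e.
  rewrite mulrA e -[LHS]mulrA -[RHS]mulrA; congr (_ * _).
  have -> : u ^+ p.-1 * s = star u * (s * u) by rewrite -pE mulrA uV mul1r.
  by rewrite -!mulrA Vu mulr1.
exact: star_hom_eq hchi star_hom_id chiu chis.
Qed.

Lemma cuntz_gen_in i : cuntz_subalgebra p u s (T i).
Proof. by move=> S [_]; apply; exists i. Qed.

Lemma extends_bogolubov_gen (M : 'M[R[i]]_p) phi i : extends_bogolubov u s M phi ->
  phi (T i) = \sum_(j < p) M j i *: T j.
Proof.
by case=> _ [lam [_ _ lamT] ->]; rewrite ?lamT // inE; apply: cuntz_gen_in.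
Qed.

(** Two extensions differ by an automorphism that fixes every T_i. *)
Lemma extension_unique (M : 'M[R[i]]_p) phi psi :
  extends_bogolubov u s M phi -> extends_bogolubov u s M psi -> phi =1 psi.
Proof.
move=> ephi epsi; have [[hphi _] _] := ephi; have [[hpsi [psi' K K']] _] := epsi.
have hpsi' := star_hom_inv hpsi K K'.
have fixT i : (psi' \o phi) (T i) = T i.
  by rewrite /= (extends_bogolubov_gen i ephi) -(extends_bogolubov_gen i epsi) K.
move=> x; have := star_hom_fix_cuntz (star_hom_comp hpsi' hphi) fixT x.
by move=> /= /(congr1 psi); rewrite K'.
Qed.

End HomsOnQp.

(** * Means twisted by a unitary matrix *)

Section UnitaryRows.
Variables (R : realType) (p : nat) (M : 'M[R[i]]_p).
Hypothesis uM : M \is unitarymx.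

Lemma unitarymx_rows i j :
  \sum_k M i k * Num.conj (M j k) = (i == j)%:R.
Proof.
have /unitarymxP/matrixP/(_ i j) := uM; rewrite !mxE => <-.
by apply: eq_bigr => k _; rewrite !mxE.
Qed.

Lemma unitarymx_row_norm i : \sum_k modulus (M i k) ^+ 2 = 1.
Proof.
apply: complexI; rewrite rmorph_sum rmorph1 /=.
have <- : \sum_k M i k * Num.conj (M i k) = 1 by rewrite unitarymx_rows eqxx.
apply: eq_bigr => k _.
by rewrite rmorphXn /= modulusE -normCK.
Qed.

Lemma unitarymx_entry_le1 i k : modulus (M i k) <= 1.
Proof.
rewrite -(@expr_le1 _ 2) ?modulus_ge0 // -(unitarymx_row_norm i) (bigD1 k) //=.
by rewrite lerDl sumr_ge0 // => j _; rewrite exprn_ge0 ?modulus_ge0.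
Qed.

(** The inequality 2 t <= 1 + t^2, summed over a row of norm 1. *)
Lemma unitarymx_row_sum i : \sum_k modulus (M i k) <= (p%:R + 1) / 2.
Proof.
apply: (@le_trans _ _ (\sum_k (1 + modulus (M i k) ^+ 2) / 2)).
  apply: ler_sum => k _; have := sqr_ge0 (modulus (M i k) - 1).
  rewrite sqrrB1; lra.
by rewrite -mulr_suml big_split /= unitarymx_row_norm sumr_const card_ord.
Qed.

End UnitaryRows.

Section Averaging.
Variables (R : realType) (p : nat) (Q : cstarType R) (u s : Q).
Hypothesis hp : (2 <= p)%N.
Hypothesis rel : Qp_relations p u s.
Hypothesis gen : cstar_gen [set u; s] = setT.

Local Notation U := (upow u).
Local Notation T := (@cuntz_gen _ p _ u s).

(** The iterates of the means below are linear maps without a bundled structure. *)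
Lemma lin_sum (f : Q -> Q) I (r : seq I) (P : pred I) (c : I -> R[i]) (F : I -> Q) :
  (forall (a : R[i]) x y, f (a *: x + y) = a *: f x + f y) ->
  f (\sum_(i <- r | P i) c i *: F i) = \sum_(i <- r | P i) c i *: f (F i).
Proof.
move=> fL; elim/big_rec2: _ => [|i x y _ <-]; last by rewrite fL.
by have := fL 1 0 0; rewrite !scale1r addr0 -{1}[f 0]addr0 => /addrI.
Qed.

Definition rotated_gen (M : 'M[R[i]]_p) i := \sum_k Num.conj (M i k) *: T k.

(** The average over i of star(T_i) v T'_i, where T'_i is the i-th generator moved by the
    inverse of the matrix M.  For unitary M it fixes each w with w T_i = lambda_M(T_i) w,
    and its iterates push every element towards the scalars. *)
Definition twisted_mean (M : 'M[R[i]]_p) (v : Q) : Q :=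
  (p%:R^-1 : R[i]) *: \sum_i star (T i) * v * rotated_gen M i.

Lemma twisted_meanL M (a : R[i]) x y :
  twisted_mean M (a *: x + y) = a *: twisted_mean M x + twisted_mean M y.
Proof.
rewrite /twisted_mean scalerA mulrC -scalerA -scalerDr; congr (_ *: _).
rewrite scaler_sumr -big_split; apply: eq_bigr => i _ /=.
by rewrite mulrDr mulrDl -scalerAr -scalerAl.
Qed.

Lemma iter_twisted_meanL M n (a : R[i]) x y :
  iter n (twisted_mean M) (a *: x + y) =
  a *: iter n (twisted_mean M) x + iter n (twisted_mean M) y.
Proof. by elim: n => // n IH; rewrite !iterS IH twisted_meanL. Qed.

(** The estimates on U c s^r thereby cover the adjoints star(s)^r U c as well. *)
Lemma star_twisted_mean M v :
  star (twisted_mean M v) = twisted_mean (map_mx Num.conj M^T) (star v).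
Proof.
rewrite /twisted_mean starZ rmorphV ?unitfE ?pnatr_eq0; last by lia.
rewrite rmorph_nat; congr (_ *: _); rewrite star_sum.
transitivity (\sum_i \sum_k M i k *: (star (T k) * star v * T i)).
  apply: eq_bigr => i _; rewrite (starM _ (rotated_gen M i)) (starM (star (T i))) starK.
  rewrite star_sum mulr_suml.
  by apply: eq_bigr => k _; rewrite starZ conjCK -scalerAl mulrA.
rewrite exchange_big; apply: eq_bigr => k _; rewrite mulr_sumr.
by apply: eq_bigr => i _; rewrite !mxE conjCK -scalerAr.
Qed.

Lemma iter_star_twisted_mean M n v :
  star (iter n (twisted_mean M) v) =
  iter n (twisted_mean (map_mx Num.conj M^T)) (star v).
Proof. by elim: n => // n IH; rewrite !iterS star_twisted_mean IH. Qed.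

Lemma twisted_mean_mulT M i v :
  twisted_mean M (T i * v) = (p%:R^-1 : R[i]) *: (v * rotated_gen M i).
Proof.
congr (_ *: _); rewrite (bigD1 i) //= big1 ?addr0 => [|j ji].
  by rewrite mulrA (cuntz_gen_orthogonal rel) eqxx mul1r.
by rewrite mulrA (cuntz_gen_orthogonal rel) (negbTE ji) !mul0r.
Qed.

Lemma starT_rotated M i j : star (T j) * rotated_gen M i = Num.conj (M i j) *: 1.
Proof.
rewrite mulr_sumr (bigD1 j) //= big1 ?addr0 => [|k kj].
  by rewrite -scalerAr (cuntz_gen_orthogonal rel) eqxx.
by rewrite -scalerAr (cuntz_gen_orthogonal rel) eq_sym (negbTE kj) scaler0.
Qed.

Lemma twisted_mean_block M i j v :
  twisted_mean M (T i * v * star (T j)) = (p%:R^-1 * Num.conj (M i j)) *: v.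
Proof.
by rewrite -mulrA twisted_mean_mulT -mulrA starT_rotated -scalerAr mulr1 scalerA.
Qed.

Lemma twisted_mean_upow M c : twisted_mean M (U c) =
  \sum_i \sum_k (p%:R^-1 * Num.conj (M i k)) *:
    (if (p%:Z %| c - i%:Z + k%:Z)%Z then U ((c - i%:Z + k%:Z) %/ p%:Z)%Z else 0).
Proof.
rewrite /twisted_mean scaler_sumr; apply: eq_bigr => i _.
rewrite mulr_sumr scaler_sumr; apply: eq_bigr => k _.
rewrite -scalerAr scalerA -(compress_upow hp rel) !cuntz_genE starM star_upow.
by rewrite [c - _]addrC !(upowD (Qp_unitary rel)) !mulrA.
Qed.

Section Unitary.
Variable M : 'M[R[i]]_p.
Hypothesis uM : M \is unitarymx.

Lemma cnorm_rotated_gen i : cnorm (rotated_gen M i) = 1.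
Proof.
apply: cnorm_isometry; rewrite /is_isometry {1}/rotated_gen star_sum mulr_suml.
transitivity (\sum_k (M i k * Num.conj (M i k)) *: (1 : Q)).
  apply: eq_bigr => k _.
  by rewrite starZ conjCK -scalerAl starT_rotated scalerA.
by rewrite -scaler_suml (unitarymx_rows uM) eqxx scale1r.
Qed.

Lemma twisted_mean_contractive v : cnorm (twisted_mean M v) <= cnorm v.
Proof.
have p0 : 0 < p%:R :> R by rewrite ltr0n; lia.
rewrite cnormZr modulusV modulus_nat mulrC ler_pdivrMr //.
rewrite (le_trans (cnorm_sum _ _ _)) //.
apply: (@le_trans _ _ (\sum_(i < p) cnorm v)); last first.
  by rewrite sumr_const card_ord mulr_natr.
apply: ler_sum => i _; rewrite cnorm_le1M ?cnorm_rotated_gen //.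
by rewrite cnormS cnorm_isometry //; apply: (cuntz_gen_isometry rel).
Qed.

Lemma iter_twisted_mean_contractive n v :
  cnorm (iter n (twisted_mean M) v) <= cnorm v.
Proof. by elim: n => // n; apply: le_trans (twisted_mean_contractive _). Qed.

(** With c = q p + i one has U c s^(r+1) = T_i U q s^r, so that its mean is
    p^-1 U q s^r T'_i, a combination of elements of the same form whose coefficients have
    absolute sum at most (p + 1) / (2 p) <= 3 / 4.  The power of s is kept because the
    factor s removed on the left comes back with T'_i. *)
Lemma iter_twisted_mean_shift n c r :
  cnorm (iter n (twisted_mean M) (U c * s ^+ r.+1)) <= (3 / 4) ^+ n.
Proof.
elim: n c => [|n IH] c.
  rewrite expr0 (le_trans (cnormM _ _)) // (cnorm_upow (Qp_unitary rel)) mul1r.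
  by rewrite cnormX_le1 // cnorm_isometry //; apply: (Qp_isometry rel).
have [q [i ->]] := int_digit hp c.
have -> : U (q * p%:Z + i%:Z) * s ^+ r.+1 = T i * (U q * s ^+ r).
  rewrite exprS mulrA addrC (upowD (Qp_unitary rel)) mulrC.
  by rewrite -[U i * _ * s]mulrA -(mul_s_upow rel) cuntz_genE !mulrA.
rewrite iterSr twisted_mean_mulT mulr_sumr scaler_sumr.
under eq_bigr => k _.
  rewrite -scalerAr scalerA cuntz_genE -mulrA [s ^+ r * _]mulrA (mul_sX_upow rel).
  rewrite -mulrA -exprSr mulrA -(upowD (Qp_unitary rel)); over.
rewrite lin_sum; last exact: iter_twisted_meanL.
rewrite (le_trans (cnorm_sum _ _ _)) //.
have p2 : 2 <= p%:R :> R by rewrite (ler_nat R 2).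
have p0 : 0 < p%:R :> R by lra.
apply: (@le_trans _ _ (\sum_k (p%:R^-1 * modulus (M i k)) * (3 / 4) ^+ n)).
  apply: ler_sum => k _; rewrite cnormZr modulusM modulusV modulus_nat modulus_conj.
  by rewrite ler_wpM2l // mulr_ge0 ?modulus_ge0 ?invr_ge0 // ltW.
rewrite -mulr_suml -mulr_sumr exprS ler_wpM2r ?exprn_ge0 //.
rewrite mulrC ler_pdivrMr //.
by apply: le_trans (unitarymx_row_sum uM i) _; lra.
Qed.

End Unitary.
End Averaging.

(** * Outerness *)

Section Outer.
Variables (R : realType) (p : nat) (Q : cstarType R) (u s : Q).
Hypothesis hp : (2 <= p)%N.
Hypothesis rel : Qp_relations p u s.
Hypothesis gen : cstar_gen [set u; s] = setT.

Local Notation U := (upow u).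
Local Notation T := (@cuntz_gen _ p _ u s).
Local Notation E := (@twisted_mean _ p _ u s).

(** Measuring the distance to the scalars by commutators with a fixed a avoids the choice
    of a nearest scalar and is linear in v. *)
Definition mean_commutator (M : 'M[R[i]]_p) (a : Q) n v :=
  iter n (E M) v * a - a * iter n (E M) v.

Local Notation D := mean_commutator.

Lemma mean_commutatorL M a n (c : R[i]) x y :
  D M a n (c *: x + y) = c *: D M a n x + D M a n y.
Proof.
rewrite /D iter_twisted_meanL mulrDl mulrDr -scalerAl -scalerAr scalerBr.
by rewrite opprD addrACA.
Qed.

Lemma mean_commutator0 M a n : D M a n 0 = 0.
Proof.
have := mean_commutatorL M a n 1 0 0.
by rewrite !scale1r !addr0 -{1}[D M a n 0]addr0 => /addrI.
Qed.

Lemma mean_commutatorS M a n v : D M a n.+1 v = D M a n (E M v).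
Proof. by rewrite /D iterSr. Qed.

Lemma star_mean_commutator M a n v :
  star (D M a n v) = - D (map_mx Num.conj M^T) (star a) n (star v).
Proof. by rewrite /D starB !starM (iter_star_twisted_mean _ _ hp) opprB. Qed.

Lemma mean_commutator_le M a n v : M \is unitarymx ->
  cnorm (D M a n v) <= (2 * cnorm a) * cnorm v.
Proof.
move=> uM; set e := iter n (E M) v.
have le : cnorm e <= cnorm v by apply: iter_twisted_mean_contractive.
have h1 := cnormB (e * a) (a * e).
have h2 := cnormM e a; have h3 := cnormM a e.
have h4 : cnorm a * cnorm e <= cnorm a * cnorm v by rewrite ler_wpM2l ?cnorm_ge0.
rewrite /D -/e; lra.
Qed.

Lemma unitarymx_adjoint (M : 'M[R[i]]_p) :
  M \is unitarymx -> map_mx Num.conj M^T \is unitarymx.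
Proof. by move=> uM; rewrite trmxC_unitary. Qed.

Lemma mean_commutator_one M a n : D M a n 1 = 0.
Proof.
have E1 : E M 1 = (p%:R^-1 * \sum_i Num.conj (M i i)) *: 1.
  rewrite -scalerA scaler_suml; congr (_ *: _); apply: eq_bigr => i _.
  by rewrite mulr1 (starT_rotated rel).
elim: n => [|n IH]; first by rewrite /D /= mulr1 mul1r subrr.
rewrite mean_commutatorS E1 -[X in D _ _ _ X]addr0 mean_commutatorL IH scaler0.
by rewrite add0r mean_commutator0.
Qed.

(** star(T_i) u T_k is a scalar except for i = 0 and k = p - 1, where it is u itself; this
    single coefficient has modulus at most 1 / p. *)
Lemma twisted_mean_gen M : M \is unitarymx ->
  exists b t, modulus t <= 2^-1 /\ E M u = t *: u + b *: 1.
Proof.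
move=> uM; pose c i k := p%:R^-1 * Num.conj (M i k).
have h0 : (0 < p)%N by lia.
have hl : (p.-1 < p)%N by lia.
pose i0 := Ordinal h0; pose k0 := Ordinal hl.
exists (\sum_i \sum_(k < p) c i k * (k.+1 == i :> nat)%:R), (c i0 k0); split.
  rewrite modulusM modulusV modulus_nat modulus_conj.
  rewrite -[leRHS]mulr1 ler_pM ?modulus_ge0 ?invr_ge0 //;
    last exact: unitarymx_entry_le1.
  by rewrite lef_pV2 ?posrE ?ltr0n ?ler_nat //; lia.
rewrite -[u in LHS]upow1 (twisted_mean_upow hp rel).
have term i k : c i k *: (if (p%:Z %| 1 - i%:Z + k%:Z)%Z
      then U ((1 - i%:Z + k%:Z) %/ p%:Z)%Z else 0) =
    (if (i == i0) && (k == k0) then c i k *: u else 0) +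
    (c i k * (k.+1 == i :> nat)%:R) *: 1.
  have ip := ltn_ord i; have kp := ltn_ord k.
  have [ki|ki] := eqVneq k.+1 (i : nat).
    have -> : 1 - i%:Z + k%:Z = 0 by lia.
    rewrite dvdz0 div0z upow0 (_ : (i == i0) = false) /=; last first.
      by apply/eqP => i00; rewrite i00 in ki.
    by rewrite add0r mulr1.
  rewrite mulr0 scale0r addr0; case: ifP => [pd|npd]; last first.
    rewrite scaler0; case: ifP => // /andP[/eqP i00 /eqP k00].
    move/negP: npd; case; apply/dvdzP; exists 1.
    by rewrite i00 k00 /=; lia.
  have /dvdzP[q qE] := pd.
  have q1 : q = 1.
    have : q <> 0 by move=> q0; move: qE; rewrite q0; move/eqP: ki; lia.
    by move: qE; nia.
  rewrite q1 in qE.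
  have -> : (i == i0) && (k == k0).
    by rewrite -!(inj_eq val_inj) /=; lia.
  by rewrite qE mul1r divzz (_ : p%:Z != 0) //; lia.
rewrite (eq_bigr _ (fun i _ => eq_bigr _ (fun k _ => term i k))).
under eq_bigr do rewrite big_split /=.
rewrite big_split /=; congr (_ + _); last first.
  by rewrite scaler_suml; apply: eq_bigr => i _; rewrite scaler_suml.
rewrite (bigD1 i0) //= [X in _ + X]big1 ?addr0 => [|i /negbTE ->]; last by rewrite big1.
by rewrite (bigD1 k0) //= eqxx big1 ?addr0 // => k /negbTE ->.
Qed.

Lemma mean_commutator_gen_vanishes M a : M \is unitarymx ->
  cnorm (D M a n u) @[n --> \oo] --> (0 : R).
Proof.
move=> uM; pose C := cnorm (D M a 0 u).
have [b [t [t2 Eu]]] := twisted_mean_gen uM.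
have half : (C * 2^-1 ^+ n) @[n --> \oo] --> (0 : R).
  by apply: cvg0Z; apply: cvg_expr; rewrite ger0_norm //; lra.
apply: cvg0_le half => n; rewrite cnorm_ge0 /=.
elim: n => [|n IH]; first by rewrite expr0 mulr1.
rewrite mean_commutatorS Eu mean_commutatorL -[b *: 1]addr0 mean_commutatorL.
rewrite mean_commutator_one scaler0 add0r.
rewrite mean_commutator0 addr0 cnormZr exprS mulrCA.
by rewrite ler_pM ?cnorm_ge0 ?modulus_ge0.
Qed.

Lemma mean_commutator_closed M a : M \is unitarymx ->
  closed_subspace [set v | cnorm (D M a n v) @[n --> \oo] --> (0 : R)].
Proof.
move=> uM; apply: (@vanishing_closed_subspace _ _ _ (2 * cnorm a)) => [n c x y|n v].
  exact: mean_commutatorL.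
exact: mean_commutator_le.
Qed.

Lemma mean_commutator_shift M a v :
  cnorm (D M a n (E M v)) @[n --> \oo] --> (0 : R) ->
  cnorm (D M a n v) @[n --> \oo] --> (0 : R).
Proof.
move=> h; rewrite -(cvg_shiftS (fun n => cnorm (D M a n v))).
rewrite (_ : (fun n => _) = (fun n => cnorm (D M a n (E M v)))) //.
by apply: funext => n; rewrite /= mean_commutatorS.
Qed.

Lemma mean_commutator_star_vanishes M a v :
  cnorm (D (map_mx Num.conj M^T) (star a) n (star v)) @[n --> \oo] --> (0 : R) ->
  cnorm (D M a n v) @[n --> \oo] --> (0 : R).
Proof.
rewrite (_ : (fun n => _) = (fun n => cnorm (D M a n v))) //.
by apply: funext => n; rewrite -[in RHS]cnormS star_mean_commutator cnormN.
Qed.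

(** The mean of U c involves the powers U q with q p = c - i + k, and |q| < |c| as soon as
    |c| >= 2.  The exponents 1 and -1 are exchanged by the adjoint. *)
Lemma mean_commutator_upow_vanishes M a c : M \is unitarymx ->
  cnorm (D M a n (U c)) @[n --> \oo] --> (0 : R).
Proof.
move=> uM; have cG := mean_commutator_closed a uM; set G := [set v | _] in cG.
have GE v : G (E M v) -> G v by apply: mean_commutator_shift.
have [m] := ubnP `|c|%N; elim: m c => // m IH c cm.
have [c2|] := ltnP 1 `|c|; last first.
  have [->|c0] := eqVneq c 0.
    move=> _; rewrite (_ : (fun n => _) = fun=> 0); first exact: cvg_cst.
    by apply: funext => n; rewrite mean_commutator_one cnorm0.
  move=> c1; have [->|->] : c = 1 \/ c = -1 by lia.
    exact: mean_commutator_gen_vanishes.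
  apply: mean_commutator_star_vanishes; rewrite star_upow opprK.
  by apply/mean_commutator_gen_vanishes/unitarymx_adjoint.
apply: (GE (U c)); rewrite (twisted_mean_upow hp rel).
apply: (closed_subspace_sum _ cG) => i _; apply: (closed_subspace_sum _ cG) => k _.
apply: (closed_subspaceZ _ cG); case: ifP => [/dvdzP[q qE]|_]; last by case: cG.
rewrite qE mulzK; last by lia.
apply: IH; have := ltn_ord i; have := ltn_ord k; move=> kp ip.
suff : (absz q < absz c)%N by lia.
have : absz (q * p%:Z) = (absz q * p)%N by rewrite abszM.
have : (absz (q * p%:Z)%R <= absz c + p.-1)%N by rewrite -qE; lia.
nia.
Qed.

(** The means tend to 0 on U c s^r for r > 0, the commutators vanish in the limit on the
    powers of u, both facts pass to adjoints, and one mean turns T_i v star(T_j) into a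
    multiple of v. *)
Lemma mean_commutator_vanishes M a v : M \is unitarymx ->
  cnorm (D M a n v) @[n --> \oo] --> (0 : R).
Proof.
move=> uM; have cG := mean_commutator_closed a uM; set G := [set v | _] in cG.
suff : G v by [].
have base N b c r : N \is unitarymx ->
    cnorm (D N b n (U c * s ^+ r)) @[n --> \oo] --> (0 : R).
  move=> uN; case: r => [|r].
    by rewrite mulr1; apply: mean_commutator_upow_vanishes.
  have q : (2 * cnorm b * (3 / 4) ^+ n) @[n --> \oo] --> (0 : R).
    apply: cvg0Z; apply: cvg_expr; rewrite ger0_norm //; lra.
  apply: cvg0_le q => n; rewrite cnorm_ge0 /=.
  have := iter_twisted_mean_shift hp rel uN n c r.
  rewrite /D; set e := iter n _ _ => e1.
  have h1 := cnormB (e * b) (b * e).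
  have h2 := cnormM e b; have h3 := cnormM b e.
  have h4 : cnorm b * cnorm e <= cnorm b * (3 / 4) ^+ n by rewrite ler_wpM2l ?cnorm_ge0.
  lra.
apply: (Qp_ind hp rel gen cG) => [c r|c r|i j x Gx]; first exact: base.
  apply: mean_commutator_star_vanishes; rewrite starM starX starK star_upow.
  by apply/base/unitarymx_adjoint.
apply: mean_commutator_shift; rewrite (twisted_mean_block rel).
exact: (closed_subspaceZ _ cG).
Qed.

(** w T'_i = T_i w by the unitarity of M, so every term of the average is w. *)
Lemma twisted_mean_fixed M w : M \is unitarymx ->
    (forall i, w * T i = \sum_(j < p) M j i *: (T j * w)) -> E M w = w.
Proof.
move=> uM wT; rewrite /twisted_mean.
have E1 i : star (T i) * w * rotated_gen u s M i = w.
  rewrite -mulrA (_ : w * _ = T i * w).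
    by rewrite mulrA (cuntz_gen_isometry rel) mul1r.
  rewrite mulr_sumr.
  transitivity (\sum_k \sum_j (M j k * Num.conj (M i k)) *: (T j * w)).
    apply: eq_bigr => k _; rewrite -scalerAr wT scaler_sumr.
    by apply: eq_bigr => j _; rewrite scalerA mulrC.
  rewrite exchange_big (bigD1 i) //= -scaler_suml (unitarymx_rows uM) eqxx scale1r.
  rewrite big1 ?addr0 // => j /negbTE ji.
  by rewrite -scaler_suml (unitarymx_rows uM) ji scale0r.
rewrite (eq_bigr _ (fun i _ => E1 i)) sumr_const card_ord.
rewrite -[w *+ p]scaler_nat scalerA.
by rewrite mulVf ?scale1r // pnatr_eq0; lia.
Qed.

(** If phi = Ad(w) then w is fixed by the twisted mean, hence commutes with every a; then
    phi is the identity, and comparing coefficients of the T_j gives M = 1. *)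
Lemma extension_outer (M : 'M[R[i]]_p) phi :
  extends_bogolubov u s M phi -> M <> 1%:M -> ~ is_inner phi.
Proof.
move=> ext M1 [w [wV Vw] phiw]; apply: M1.
have uM : M \is unitarymx by case: ext => _ [lam []].
have wT i : w * T i = \sum_(j < p) M j i *: (T j * w).
  have := extends_bogolubov_gen i ext; rewrite phiw => /(congr1 ( *%R^~ w)).
  rewrite -mulrA wV mulr1 mulr_suml => ->.
  by apply: eq_bigr => j _; rewrite -[LHS]scalerAl.
have fixw n : iter n (E M) w = w.
  by elim: n => // n IH; rewrite iterS IH twisted_mean_fixed.
have central a : w * a = a * w.
  apply: (converges_unique (converges_cst _)); rewrite /converges.
  rewrite (_ : (fun n => _) = (fun n => cnorm (D M a n w))).
    exact: mean_commutator_vanishes.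
  by apply: funext => n; rewrite /D fixw.
apply/matrixP => k i; rewrite !mxE.
have TE : T i = \sum_(j < p) M j i *: T j.
  have := wT i; rewrite central => /(congr1 ( *%R^~ (star w))).
  rewrite -mulrA Vw mulr1 mulr_suml => {1}->.
  by apply: eq_bigr => j _; rewrite -scalerAl -mulrA Vw mulr1.
have := cuntz_gen_orthogonal rel k i; rewrite {1}TE mulr_sumr (bigD1 k) //=.
rewrite big1 ?addr0 => [|j jk]; last first.
  by rewrite -scalerAr (cuntz_gen_orthogonal rel) eq_sym (negbTE jk) scaler0.
have -> : (k == i)%:R = ((k == i)%:R : R[i]) *: (1 : Q) by rewrite scaler_nat.
rewrite -scalerAr (cuntz_gen_orthogonal rel) eqxx mulr1n => /eqP.
by rewrite -subr_eq0 -scalerBl scaler_eq0 oner_eq0 orbF subr_eq0 => /eqP.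
Qed.

End Outer.

(** * The action of T x Z/2Z *)

Section Symmetries.
Variables (R : realType) (p : nat) (Q : cstarType R) (u s : Q).
Hypothesis hp : (2 <= p)%N.

Local Notation U := (upow u).
Local Notation T := (@cuntz_gen _ p _ u s).
Local Notation S := (cuntz_subalgebra p u s).
Implicit Types g h : TxZ2 R.

Lemma circle_conj (z : circle R) : (z : R[i]) * Num.conj (z : R[i]) = 1.
Proof. by rewrite -normCK (eqP (circle_norm z)) expr1n. Qed.

Lemma TxZ2_mx_unitary g : TxZ2_mx p g \is unitarymx.
Proof.
apply/unitarymxP/matrixP => i k; rewrite !mxE.
pose f (i : 'I_p) := if g.2 then rev_ord i else i.
have fI : injective f by rewrite /f; case: g.2 => //; apply: rev_ord_inj.
have E (m j : 'I_p) : TxZ2_mx p g m j = (g.1 : R[i]) * (j == f m)%:R.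
  by rewrite !mxE /f; case: g.2; rewrite !mxE // eq_sym.
rewrite (bigD1 (f i)) //= big1 ?addr0 => [|j /negbTE ji]; last first.
  by rewrite E ji mulr0 mul0r.
rewrite [X in _ * X]mxE [X in _ * Num.conj X]mxE !E eqxx mulr1.
by rewrite rmorphM /= mulrA circle_conj mul1r (inj_eq fI) rmorph_nat.
Qed.

Definition sym_u g : Q := if g.2 then star u else u.
Definition sym_s g : Q :=
  (g.1 : R[i]) *: (if g.2 then u ^+ p.-1 * s else s).

Hypothesis rel : Qp_relations p u s.

(** For the exchange matrix, (star u)^i u^(p-1) s = u^(p-1-i) s reverses the indices. *)
Lemma sym_cuntz_gen g (i : 'I_p) : sym_u g ^+ i * sym_s g =
  (g.1 : R[i]) *: T (if g.2 then rev_ord i else i).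
Proof.
rewrite /sym_u /sym_s -scalerAr; congr (_ *: _); case: g.2 => //.
have -> : star u ^+ i = U (- i%:Z) by rewrite -star_upow /= starX.
rewrite cuntz_genE mulrA -[u ^+ _]/(U p.-1) -(upowD (Qp_unitary rel)).
by congr (U _ * _); have := ltn_ord i; rewrite /=; lia.
Qed.

Lemma sym_cuntz_sum g (i : 'I_p) :
  sym_u g ^+ i * sym_s g = \sum_(j < p) TxZ2_mx p g j i *: T j.
Proof.
rewrite sym_cuntz_gen (bigD1 (if g.2 then rev_ord i else i)) //=.
rewrite big1 ?addr0 => [|j ji].
  by rewrite !mxE; case: g.2; rewrite !mxE ?rev_ordK eqxx mulr1.
rewrite !mxE; case: g.2 ji; rewrite !mxE => ji.
  by rewrite eq_sym (can2_eq (@rev_ordK _) (@rev_ordK _)) (negbTE ji) mulr0 scale0r.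
by rewrite (negbTE ji) mulr0 scale0r.
Qed.

Lemma sym_relations g : Qp_relations p (sym_u g) (sym_s g).
Proof.
have [uV Vu] := Qp_unitary rel.
have D := upowD (Qp_unitary rel).
have zz : Num.conj (g.1 : R[i]) * (g.1 : R[i]) = 1 by rewrite mulrC circle_conj.
have h0 : (0 < p)%N by lia.
have symI (i : 'I_p) : is_isometry (sym_u g ^+ i * sym_s g).
  rewrite sym_cuntz_gen /is_isometry starZ -scalerAl -scalerAr scalerA zz scale1r.
  exact: (cuntz_gen_isometry rel).
split.
- by rewrite /sym_u; case: g.2; split; rewrite ?starK.
- by have := symI (Ordinal h0); rewrite /= mul1r.
- rewrite /sym_u /sym_s; case: g.2; rewrite -scalerAr -scalerAl; congr (_ *: _).
    have -> : star u ^+ p = U (- p%:Z) by rewrite -star_upow /= starX.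
    rewrite -[LHS]mulrA -[star u]/(U (- 1)) (mul_s_upow rel) !mulrA.
    by rewrite -[u ^+ _]/(U p.-1) -!D mulrN1 addrC.
  by case: rel.
- rewrite -(cuntz_sum rel).
  pose f (i : 'I_p) := if g.2 then rev_ord i else i.
  have fI : injective f by rewrite /f; case: g.2 => //; apply: rev_ord_inj.
  rewrite [RHS](reindex_inj fI); apply: eq_bigr => i _.
  rewrite -starX -mulrA -[_ * star (_ ^+ _)]starM sym_cuntz_gen -/(f i).
  by rewrite starZ -scalerAl -scalerAr scalerA mulrC zz scale1r.
Qed.

End Symmetries.

Section Action.
Variables (R : realType) (p : nat) (Q : cstarType R) (u s : Q).
Hypothesis hp : (2 <= p)%N.
Hypothesis hQ : is_Qp p u s.

Local Notation U := (upow u).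
Local Notation T := (@cuntz_gen _ p _ u s).
Local Notation S := (cuntz_subalgebra p u s).
Implicit Types g h : TxZ2 R.

Let rel : Qp_relations p u s. Proof. by case: hQ. Qed.
Let gen : cstar_gen [set u; s] = setT. Proof. by case: hQ. Qed.

(** The images of u and s prescribed by the two families of extensions satisfy the
    defining relations, so the universal property yields an endomorphism. *)
Fact sym_ex g :
  exists f : Q -> Q, [/\ star_hom f, f u = sym_u u g & f s = sym_s p u s g].
Proof. by case: hQ => _ _; apply; apply: sym_relations. Qed.

Definition sym g : Q -> Q := sval (cid (sym_ex g)).

Lemma sym_hom g : star_hom (sym g).
Proof. by rewrite /sym; case: cid => f []. Qed.

Lemma sym_uE g : sym g u = sym_u u g.
Proof. by rewrite /sym; case: cid => f []. Qed.

Lemma sym_sE g : sym g s = sym_s p u s g.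
Proof. by rewrite /sym; case: cid => f []. Qed.

Lemma symT g i : sym g (T i) = \sum_(j < p) TxZ2_mx p g j i *: T j.
Proof.
by rewrite (homM (sym_hom g)) (homX (sym_hom g)) sym_uE sym_sE sym_cuntz_sum.
Qed.

Lemma sym1 x : sym 1%g x = x.
Proof.
apply: (star_hom_eq gen (sym_hom _) (star_hom_id Q)); first by rewrite sym_uE.
by rewrite sym_sE /sym_s /= scale1r.
Qed.

Lemma symM g h x : sym (g * h)%g x = sym g (sym h x).
Proof.
have [uV Vu] := Qp_unitary rel.
have ppow : star u ^+ p.-1 * u ^+ p.-1 = 1.
  by have [+ _] := upow_unitary (Qp_unitary rel) p.-1; rewrite /= starX.
apply: (star_hom_eq gen (sym_hom _) (star_hom_comp (sym_hom g) (sym_hom h))) => /=.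
  rewrite !sym_uE /sym_u /=; case: h.2; rewrite ?(homS (sym_hom _)) sym_uE /sym_u.
    by case: g.2; rewrite /= ?starK.
  by case: g.2.
rewrite !sym_sE /sym_s (homZ (sym_hom g)) /=.
case: h.2 => /=; rewrite ?(homM (sym_hom g)) ?(homX (sym_hom g)) sym_sE ?sym_uE;
  rewrite /sym_s /sym_u.
  rewrite -scalerAr scalerA [(h.1 : R[i]) * _]mulrC; congr (_ *: _).
  by case: (g.2); rewrite /= ?mulrA ?ppow ?mul1r.
by rewrite scalerA [(h.1 : R[i]) * _]mulrC addbF.
Qed.

Lemma sym_automorphism g : star_automorphism (sym g).
Proof.
split; first exact: sym_hom.
by exists (sym g^-1%g) => x; rewrite -symM ?mulVg ?mulgV sym1.
Qed.

Lemma cuntz_subalgebra_closed : cstar_subalgebra S.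
Proof.
split=> [B [cB _]|a x y Sx Sy B SB|x y Sx Sy B SB|x Sx B SB|x l Sx xl B SB].
- by case: cB.
- by have [[_ c _ _ _] _] := SB; apply: c; [apply: Sx | apply: Sy].
- by have [[_ _ c _ _] _] := SB; apply: c; [apply: Sx | apply: Sy].
- by have [[_ _ _ c _] _] := SB; apply: c; apply: Sx.
- by have [[_ _ _ _ c] _] := SB; apply: c xl => n; apply: Sx.
Qed.

Lemma sym_cuntz_subalgebra g x : S x -> S (sym g x).
Proof.
have hg := sym_hom g; have [S0 SL SM SS SC] := cuntz_subalgebra_closed.
move=> /(_ [set y | S (sym g y)]); apply; split; first split=> /=.
- by rewrite (hom0 hg).
- by move=> a y z Sy Sz; rewrite (homL hg); apply: SL.
- by move=> y z Sy Sz; rewrite (homM hg); apply: SM.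
- by move=> y Sy; rewrite (homS hg); apply: SS.
- move=> y l Sy yl; apply: (SC (sym g \o y)) => //.
  exact: hom_converges.
- move=> _ [i _ <-] /=; rewrite symT.
  elim/big_rec: _ => [//|j y _ Sy]; apply: SL => //.
  exact: cuntz_gen_in.
Qed.

Lemma sym_extends g : extends_bogolubov u s (TxZ2_mx p g) (sym g).
Proof.
split; first exact: sym_automorphism.
exists (sym g) => //; have hg := sym_hom g.
split; [exact: TxZ2_mx_unitary| |exact: symT].
split=> [|a x y _ _|x y _ _|x _]; rewrite ?(homL hg) ?(homM hg) ?(homS hg) //.
split=> [x|x y _ _ e|x Sx].
- exact: sym_cuntz_subalgebra.
- by rewrite -[x]sym1 -[y]sym1 -(mulVg g) !symM e.
- exists (sym g^-1%g x); first exact: sym_cuntz_subalgebra.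
  by rewrite -symM mulgV sym1.
Qed.

Lemma TxZ2_near g (e : R) : 0 < e ->
  nbhs g [set h : TxZ2 R |
    h.2 = g.2 /\ modulus ((h.1 : R[i]) - (g.1 : R[i])) < e].
Proof.
move=> e0; case: g => z b.
have zn : nbhs z [set w : circle R | modulus ((w : R[i]) - (z : R[i])) < e].
  have cz : continuous (fun w : circle R => (w : R[i]^o)) by apply: initial_continuous.
  have e0' : 0 < e%:C%C :> R[i] by rewrite ltcR.
  have /cvgrPdist_lt/(_ _ e0') := cz z.
  apply: filterS => w /=.
  by rewrite -modulusE ltcR -modulusN opprB.
have bn : nbhs b [set c : bool | c = b] by apply: discrete_set1.
exists ([set w : circle R | modulus ((w : R[i]) - (z : R[i])) < e],
  [set c | c = b]) => //=.
by move=> [w c] /= [].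
Qed.

(** The endomorphisms are uniformly bounded by contractivity, so the points of norm
    continuity form a C*-subalgebra; at u and s the orbit maps are explicit. *)
Lemma sym_continuous x g : cnorm (sym h x - sym g x) @[h --> g] --> (0 : R).
Proof.
have bound (y : Q) h : cnorm (sym h y) <= cnorm y.
  exact: hom_contractive (sym_hom h) y.
have : cstar_gen [set u; s] x by rewrite gen.
move=> /(_ [set y | cnorm (sym h y - sym g y) @[h --> g] --> (0 : R)]).
apply; split; first split=> /=.
- rewrite (_ : (fun h => _) = fun=> 0); first exact: cvg_cst.
  by apply: funext => h; rewrite !(hom0 (sym_hom _)) subrr cnorm0.
- move=> a y z cy cz; apply: cvg0_le (cvg0D (cvg0Z (modulus a) cy) cz) => h.
  rewrite cnorm_ge0 !(homL (sym_hom _)) -cnormZr scalerBr opprD addrACA.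
  exact: cnormD.
- move=> y z cy cz.
  apply: cvg0_le (cvg0D (cvg0Z (cnorm z) cy) (cvg0Z (cnorm y) cz)) => h.
  rewrite cnorm_ge0 !(homM (sym_hom _)).
  have -> : sym h y * sym h z - sym g y * sym g z =
      (sym h y - sym g y) * sym h z + sym g y * (sym h z - sym g z).
    by rewrite mulrBl mulrBr addrA subrK.
  rewrite (le_trans (cnormD _ _)) // lerD // (le_trans (cnormM _ _)) //.
    by rewrite mulrC ler_wpM2r ?cnorm_ge0.
  by rewrite ler_wpM2r ?cnorm_ge0.
- move=> y cy; rewrite (_ : (fun h => _) = fun h => cnorm (sym h y - sym g y)) //.
  by apply: funext => h; rewrite !(homS (sym_hom _)) -starB cnormS.
- move=> y l cy yl; apply/cvgr0Pnorm_lt => e e0.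
  have e3 : 0 < e / 3 by rewrite divr_gt0.
  have /cvg0P -/(_ (fun=> cnorm_ge0 _) _ e3)[N /(_ N (leqnn N)) hN] := yl.
  have /cvgr0Pnorm_lt/(_ _ e3) := cy N; apply: filterS => h.
  rewrite !ger0_norm ?cnorm_ge0 // => hh.
  have h1 := bound (y N - l) h; have h2 := bound (y N - l) g.
  rewrite !(homB (sym_hom _)) in h1 h2.
  have h3 := cnorm_dist_trans (sym h (y N)) (sym h l) (sym g l).
  have h4 := cnorm_dist_trans (sym g (y N)) (sym h (y N)) (sym g l).
  rewrite cnorm_distrC in h1; lra.
- move=> y ys /=; apply/cvgr0Pnorm_lt => e e0.
  pose C := cnorm (if g.2 then u ^+ p.-1 * s else s) + 1.
  have C0 : 0 < C by rewrite ltr_wpDl ?cnorm_ge0.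
  have eC : 0 < e / C by rewrite divr_gt0.
  apply: filterS (TxZ2_near g eC) => h [h2 h1].
  rewrite ger0_norm ?cnorm_ge0 //; case: ys => ->.
    by rewrite !sym_uE /sym_u h2 subrr cnorm0.
  rewrite !sym_sE /sym_s h2 -scalerBl cnormZr.
  move: h1; rewrite ltr_pdivlMr // => h1; apply: le_lt_trans h1.
  by rewrite ler_wpM2l ?modulus_ge0 // lerDl.
Qed.

Lemma sym_action : is_action sym.
Proof.
split; [exact: sym_automorphism|exact: sym1|exact: symM|exact: sym_continuous].
Qed.

Lemma TxZ2_mx_neq1 g : g <> 1%g -> TxZ2_mx p g <> 1%:M.
Proof.
have h0 : (0 < p)%N by lia.
case: g => z b g1 /matrixP E; apply: g1; pose i0 := Ordinal h0.
have := E i0 i0; rewrite !mxE eqxx /=.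
case: b E => E; rewrite !mxE.
  rewrite -(inj_eq val_inj) /= (_ : (0 == _)%N = false) ?mulr0; last by lia.
  by move=> /esym/eqP; rewrite oner_eq0.
rewrite eqxx mulr1 => z1; congr (_, _); exact/val_inj.
Qed.

End Action.

Theorem corollary6p20 (R : realType) (p : nat) (hp : (2 <= p)%N)
    (Q : cstarType R) (u s : Q) (hQ : is_Qp p u s) :
  (* an automorphism of Q_p extending lambda_M is determined by M *)
  (forall (M : 'M[R[i]]_p) (phi psi : Q -> Q),
     extends_bogolubov u s M phi -> extends_bogolubov u s M psi ->
     phi =1 psi) /\
  (* the extensions of the lambda_{zB} form an outer action of T x Z/2Z *)
  (exists2 alpha : TxZ2 R -> Q -> Q,
     forall g, extends_bogolubov u s (TxZ2_mx p g) (alpha g) &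
     is_outer_action alpha) /\
  (* every non-trivial extendible Bogolubov automorphism acts outerly *)
  (forall (M : 'M[R[i]]_p) (phi : Q -> Q),
     extends_bogolubov u s M phi -> M <> 1%:M -> ~ is_inner phi).
Proof.
have [rel gen _] := hQ; split; [|split].
- by move=> M phi psi; apply: extension_unique.
- exists (sym hp hQ); first exact: sym_extends.
  split; first exact: sym_action.
  move=> g /(TxZ2_mx_neq1 hp); apply: (extension_outer hp rel gen).
  exact: sym_extends.
- by move=> M phi; apply: extension_outer.
Qed.
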